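(* Let $G$ be a countable discrete amenable group, let $(\mathfrak{M}, \rho, G, \Xi)$ be a W*-dynamical system with $\mathcal{L}^2(\mathfrak{M}, \rho)$ separable, and let $(\mathfrak{A}, G, \Theta; \iota)$ be a faithful C*-model of $(\mathfrak{M}, \rho, G, \Xi)$ with $\mathfrak{A}$ separable. Consider the following conditions. (i) The C*-dynamical system $(\mathfrak{A}, G, \Theta)$ is uniquely ergodic. (ii) The C*-dynamical system $(\mathfrak{A}, G, \Theta)$ is strictly ergodic. (iii) $\Gamma(a) = \rho(\iota(a))$ for all positive $a \in \mathfrak{A}$. Then (i) and (ii) are equivalent, and (i) implies (iii). Further, if $\mathcal{S}^G$ is a simplex, then (iii) implies (i).
   Context: A C*-dynamical system $(\mathfrak{A}, G, \Theta)$ (with $G$ discrete) consists of a unital C*-algebra $\mathfrak{A}$ and a left action $\Theta : G \to \operatorname{Aut}(\mathfrak{A})$ by *-automorphisms. $\mathcal{S}^G$ is the set of $\Theta$-invariant states of $\mathfrak{A}$ with the weak*-topology. The system is uniquely ergodic if $\mathcal{S}^G$ is a singleton, and strictly ergodic if it is uniquely ergodic and its unique invariant state is faithful. A W*-dynamical system $(\mathfrak{M}, \rho, G, \Xi)$ consists of a von Neumann algebra $\mathfrak{M}$, a faithful normal tracial state $\rho$ on $\mathfrak{M}$, and a left action $\Xi$ of $G$ on $\mathfrak{M}$ by $\rho$-preserving *-automorphisms. $\mathcal{L}^2(\mathfrak{M}, \rho)$ is the Hilbert space completion of $\mathfrak{M}$ for the inner product $\langle x, y \rangle_\rho = \rho(y^*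 x)$. A C*-model $(\mathfrak{A}, G, \Theta; \iota)$ consists of a C*-dynamical system $(\mathfrak{A}, G, \Theta)$ and a *-homomorphism $\iota : \mathfrak{A} \to \mathfrak{M}$ such that $\iota(\mathfrak{A})$ is dense in $\mathfrak{M}$ in the weak operator topology, $\Xi_g(\iota(\mathfrak{A})) = \iota(\mathfrak{A})$ and $\Xi_g \circ \iota = \iota \circ \Theta_g$ for all $g \in G$. It is faithful if $\iota$ is injective. For positive $a \in \mathfrak{A}$, the gauge is $\Gamma(a) = \lim_{k \to \infty} \left\| \frac{1}{|F_k|} \sum_{g \in F_k} \Theta_g a \right\|$, where $(F_k)_{k=1}^\infty$ is a right Følner sequence for $G$ (nonempty finite sets with $|F_k g \,\Delta\, F_k|/|F_k| \to 0$ for every $g \in G$); the limit exists and does not depend on the choice of the right Følner sequence. A compact subset $K$ of a locally convex real topological vector space $V$, contained in a hyperplane not containing the origin, is a simplex if the cone $P = \{ck : c \geq 0, k \in K\}$ defines a lattice ordering on $P - P$ via $a \leq b \iff b - a \in P$. Here $V$ is the space of self-adjoint bounded linear functionals on $\mathfrak{A}$ with the weak*-topology. *)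

(* Defs.v *)
From HB Require Import structures.
From mathcomp Require Import all_boot all_order all_algebra finmap complex.
From mathcomp Require Import all_classical all_reals all_analysis.

Set Implicit Arguments.
Unset Strict Implicit.
Unset Printing Implicit Defensive.

Import Order.TTheory GRing.Theory Num.Theory.
Import numFieldNormedType.Exports.

Local Open Scope classical_set_scope.
Local Open Scope ring_scope.
Local Open Scope complex_scope.

HB.instance Definition _ (R : rcfType) := GRing.ComAlgebra.copy R[i] R[i]^o.
HB.instance Definition _ (R : rcfType) := Vector.copy R[i] R[i]^o.
HB.instance Definition _ (R : rcfType) := NormedModule.copy R[i] R[i]^o.

(* The multiplication is a field of the mixin, rather than inherited from
   [GRing.Algebra], because the MathComp hierarchy declares no join of rings
   and normed Z-modules below [Num.NumDomain]. *)
HB.mixin Record isCStarAlgebra (R : realType) A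
    & CompleteNormedModule R[i] A := {
  aone : A ;
  amul : A -> A -> A ;
  star : A -> A ;
  amulA : associative amul ;
  amul1x : left_id aone amul ;
  amulx1 : right_id aone amul ;
  amul_linearl : forall y, linear (amul^~ y) ;
  amul_linearr : forall x, linear (amul x) ;
  starK : involutive star ;
  starD : {morph star : x y / x + y} ;
  starZ : forall (c : R[i]) x, star (c *: x) = Num.conj c *: star x ;
  starM : forall x y, star (amul x y) = amul (star y) (star x) ;
  normr_amul : forall x y : A, `|amul x y| <= `|x| * `|y| ;
  cstar_identity : forall x : A, `|amul (star x) x| = `|x| ^+ 2
}.

#[short(type="cstarAlgType")]
HB.structure Definition CStarAlgebra (R : realType) :=
  {A of isCStarAlgebra R A & CompleteNormedModule R[i] A}.

Notation "x ** y" := (amul x y) (at level 40, left associativity) : ring_scope.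

Section CStarTheory.
Context {R : realType} {A : cstarAlgType R}.

Definition positive (a : A) := exists b : A, a = star b ** b.

Definition self_adjoint (a : A) := star a = a.

Definition alg_le (a b : A) := positive (b - a).

Definition is_state (f : A -> R[i]) :=
  [/\ scalar f, forall a, positive a -> 0 <= f a & f aone = 1].

Definition faithful (f : A -> R[i]) :=
  forall a, positive a -> f a = 0 -> a = 0.

Definition tracial (f : A -> R[i]) := forall a b, f (a ** b) = f (b ** a).

Definition is_lub_sa (D : set A) (s : A) :=
  (forall x, D x -> alg_le x s) /\
  (forall u, self_adjoint u -> (forall x, D x -> alg_le x u) -> alg_le s u).

(* Order continuity: [f] preserves the suprema of increasing nets of
   self-adjoint elements; such a net is represented by its range, a nonempty
   upward directed set. *)
Definition normal (f : A -> R[i]) :=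
  forall (D : set A) (s : A),
    D `<=` self_adjoint -> D !=set0 ->
    (forall x y, D x -> D y -> exists z, [/\ D z, alg_le x z & alg_le y z]) ->
    self_adjoint s -> is_lub_sa D s ->
    supremums [set f x | x in D] (f s).

End CStarTheory.

(* Unitality is not required; it is automatic for automorphisms and for maps with
   dense range. *)
Definition star_hom (R : realType) (A B : cstarAlgType R) (f : A -> B) :=
  [/\ linear f, {morph f : x y / x ** y} & {morph f : x / star x}].

Definition star_aut (R : realType) (A : cstarAlgType R) (f : A -> A) :=
  star_hom f /\ bijective f.

Definition separable (T : topologicalType) :=
  exists2 D : set T, countable D & dense D.

Section SelfAdjointDual.
Context {R : realType} (A : cstarAlgType R).

Definition is_sa_functional (f : A -> R[i]) :=
  [/\ scalar f, exists k, forall a, `|f a| <= k * `|a|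
    & forall a, f (star a) = Num.conj (f a)].

(* [Rcomplex R] is [R[i]] viewed as a real vector space. *)
Definition sa_functional : {pred A -> Rcomplex R} :=
  fun f => `[< is_sa_functional f >].

Record sa_dual := SaDual {
  sa_fun :> A -> Rcomplex R ;
  sa_funP : sa_fun \in sa_functional }.

HB.instance Definition _ := [isSub for sa_fun].
HB.instance Definition _ := [Choice of sa_dual by <:].

Let scaleRcE (r : R) (z : Rcomplex R) : r *: z = (r%:C * (z : R[i])) :> R[i].
Proof. by case: z => a b; apply/eqP; rewrite eq_complex/= !mul0r subr0 addr0 !eqxx. Qed.

Let sa_functional_submod_closed : submod_closed sa_functional.
Proof.
split.
  apply/asboolP; split => [c x y /=||a /=]; first by rewrite mulr0 addr0.
    by exists 0 => a /=; rewrite normr0 mul0r.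
  by rewrite rmorph0.
move=> r f g /asboolP[fl [kf fb] fs] /asboolP[gl [kg gb] gs].
have E a : (r *: f + g) a = (r%:C * (f a : R[i]) + g a) :> R[i].
  by rewrite -scaleRcE.
apply/asboolP; split => [c x y||a].
- rewrite !E [X in r%:C * X]fl [X in _ + X = _]gl !mulrDr.
  by rewrite (mulrCA r%:C) addrACA.
- exists (`|r%:C| * kf + kg) => a; rewrite E.
  rewrite (le_trans (ler_normD _ _))// mulrDl lerD//.
  by rewrite normrM -mulrA ler_wpM2l.
- rewrite !E fs gs rmorphD rmorphM; congr (_ * _ + _).
  by apply/eqP; rewrite eq_complex/= oppr0 !eqxx.
Qed.

HB.instance Definition _ := GRing.isSubmodClosed.Build R (A -> Rcomplex R)
  sa_functional sa_functional_submod_closed.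
HB.instance Definition _ := [SubChoice_isSubLmodule of sa_dual by <:].

(* The weak* topology is the one induced by pointwise convergence. *)
Definition sa_dual_ptws (phi : sa_dual) : {ptws A -> R[i]} := phi.

HB.instance Definition _ :=
  Uniform.copy sa_dual (initial_topology sa_dual_ptws).

Lemma sa_dual_eval_continuous (a : A) :
  continuous (fun phi : sa_dual => phi a : R[i]).
Proof.
move=> phi.
apply: (@continuous_comp sa_dual {ptws A -> R[i]} R[i] sa_dual_ptws
  (fun f => f a)).
  exact: initial_continuous.
exact: (@proj_continuous {classic A} (fun=> R[i]) a).
Qed.

Let cvg_initial (S : choiceType) (T : topologicalType) (f : S -> T)
    (F : set_system S) (s : S) : Filter F ->
  f @ F --> f s -> F --> (s : initial_topology f).
Proof.
move=> FF fFs B /= [_ [[C oC <-] /= Cfs] CB].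
by apply: filterS CB _; apply: fFs; exact: open_nbhs_nbhs.
Qed.

Lemma cvg_sa_dual (F : set_system sa_dual) (phi : sa_dual) : Filter F ->
  (forall a, (fun psi : sa_dual => psi a : R[i]) @ F --> (phi a : R[i])) ->
  F --> phi.
Proof.
move=> FF Fphi; apply: cvg_initial; apply/cvg_sup => a.
apply: (@cvg_initial {ptws A -> R[i]} R[i] (fun f => f a)).
exact: Fphi.
Qed.

Let sa_dual_add_continuous : continuous (fun x : sa_dual * sa_dual => x.1 + x.2).
Proof.
move=> x; apply: cvg_sa_dual => a /=.
apply: (@cvgD _ R[i] _ (nbhs x) _ (fun z : sa_dual * sa_dual => z.1 a : R[i])
   (fun z => z.2 a : R[i])).
- apply: (@continuous_comp _ _ _ fst (fun psi : sa_dual => psi a : R[i])).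
    exact: cvg_fst.
  exact: sa_dual_eval_continuous.
- apply: (@continuous_comp _ _ _ snd (fun psi : sa_dual => psi a : R[i])).
    exact: cvg_snd.
  exact: sa_dual_eval_continuous.
Qed.

Lemma sa_dual_scaleE (r : R) (phi : sa_dual) (a : A) :
  (r *: phi) a = (r%:C * (phi a : R[i])) :> R[i].
Proof. exact: scaleRcE. Qed.

Let real_complex_continuous : continuous (fun r : R^o => r%:C : R[i]).
Proof.
move=> r; apply/cvgrPdist_lt => -[e d]; rewrite ltcE/= => /andP[/eqP-> e0].
near=> s => /=.
rewrite -rmorphB normc_def/= expr0n/= addr0 sqrtr_sqr ltcR; near: s.
exact: (@cvgr_dist_lt _ R^o _ (nbhs r) _ id r).
Unshelve. all: by end_near. Qed.

Let sa_dual_scale_continuous : continuous (fun z : R^o * sa_dual => z.1 *: z.2).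
Proof.
move=> x; apply: cvg_sa_dual => a.
have : (fun z : R^o * sa_dual => (z.1)%:C * (z.2 a : R[i])) @ x -->
    (x.1)%:C * (x.2 a : R[i]).
  apply: (@cvgM R[i] _ (nbhs x) _ (fun z : R^o * sa_dual => (z.1)%:C)
     (fun z => z.2 a : R[i])).
  - apply: (@continuous_comp _ _ _ fst (fun r : R^o => r%:C : R[i])).
      exact: cvg_fst.
    exact: real_complex_continuous.
  - apply: (@continuous_comp _ _ _ snd (fun psi : sa_dual => psi a : R[i])).
      exact: cvg_snd.
    exact: sa_dual_eval_continuous.
rewrite -sa_dual_scaleE; apply: cvg_trans.
rewrite (_ : (fun z : R^o * sa_dual => _) =
  (fun z : R^o * sa_dual => (z.1 *: z.2) a : R[i])); first exact: cvg_id.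
by apply/funext => z; rewrite -sa_dual_scaleE.
Qed.

Let sa_dual_locally_convex :
  exists2 B : set_system sa_dual,
    (forall b, b \in B -> convex_set b) & basis B.
Proof.
exists [set U | open U /\ convex_set U] => [U|].
  by rewrite inE => -[].
split=> [U []//|phi /=].
pose F : set_system sa_dual := filter_from
  [set U | [/\ open U, convex_set U & U phi]] id.
have FF : Filter F.
  apply: filter_from_filter.
    exists [set: sa_dual]; split => //.
      exact: openT.
  move=> U V [oU cU Uphi] [oV cV Vphi]; exists (U `&` V) => //; split => //.
    exact: openI.
  move=> x y l; rewrite !in_setI => /andP[xU xV] /andP[yU yV].
  by rewrite cU//= cV.
have : F --> phi.
  apply: cvg_sa_dual => a; apply/cvgrPdist_lt => e e0.
  exists [set psi : sa_dual | `|(phi a : R[i]) - psi a| < e] => //; split.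
  - have -> : [set psi : sa_dual | `|(phi a : R[i]) - psi a| < e] =
        (fun psi : sa_dual => psi a : R[i]) @^-1` ball (phi a : R[i]) e by [].
    apply: open_comp; last exact: ball_open.
    by move=> psi _; exact: sa_dual_eval_continuous.
  - apply/convex_setW => x y /[!inE] /= xe ye l l0 l1.
    rewrite inE; set t := l%:num.
    change (`|(phi a : R[i]) - (t *: x + (1 - t) *: y : sa_dual) a| < e).
    have -> : (phi a : R[i]) - (t *: x + (1 - t) *: y : sa_dual) a =
        t%:C * ((phi a : R[i]) - x a) + (1 - t)%:C * ((phi a : R[i]) - y a).
      have -> : ((t *: x + (1 - t) *: y : sa_dual) a : R[i]) =
          t%:C * (x a : R[i]) + (1 - t)%:C * (y a : R[i]).
        by rewrite -!sa_dual_scaleE.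
      rewrite !mulrBr addrACA -opprD -mulrDl -rmorphD.
      by rewrite [t + _]addrC subrK rmorph1 mul1r.
    have -> : e = t%:C * e + (1 - t)%:C * e.
      by rewrite -mulrDl -rmorphD addrC subrK rmorph1 mul1r.
    rewrite (le_lt_trans (ler_normD _ _))// !normrM.
    have tC : 0 < t%:C :> R[i] by rewrite ltcR.
    have t1C : 0 < (1 - t)%:C :> R[i] by rewrite ltcR subr_gt0.
    by rewrite (gtr0_norm tC) (gtr0_norm t1C) ltrD // ltr_pM2l.
  - by rewrite /= subrr normr0.
move=> Fphi N /Fphi[U [oU cU Uphi] UN]; exists U => //; split => //.
Qed.

HB.instance Definition _ :=
  PreTopologicalNmodule_isTopologicalNmodule.Build sa_dual
    sa_dual_add_continuous.
HB.instance Definition _ :=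
  TopologicalNmodule_isTopologicalLmodule.Build R sa_dual
    sa_dual_scale_continuous.
HB.instance Definition _ :=
  Uniform_isTvs.Build R sa_dual sa_dual_locally_convex.

End SelfAdjointDual.

Section Simplex.
Context {R : realType} {V : tvsType R}.

Definition hyperplane (f : V -> R) (c : R) : set V := [set v | f v = c].

Definition cone_over (K : set V) : set V :=
  [set c *: k | c in [set c : R | 0 <= c] & k in K].

Definition cone_span (P : set V) : set V := [set p - q | p in P & q in P].

Definition cone_le (P : set V) (a b : V) := P (b - a).

Definition lattice_order_on (E : set V) (le : V -> V -> Prop) :=
  [/\ forall a, E a -> le a a,
      forall a b, E a -> E b -> le a b -> le b a -> a = b,
      forall a b c, E a -> E b -> E c -> le a b -> le b c -> le a c,
      forall a b, E a -> E b -> exists s, [/\ E s, le a s, le b s &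
        forall u, E u -> le a u -> le b u -> le s u]
    & forall a b, E a -> E b -> exists i, [/\ E i, le i a, le i b &
        forall l, E l -> le l a -> le l b -> le l i]].

Definition is_simplex (K : set V) :=
  [/\ compact K,
      exists (f : V -> R) (c : R),
        [/\ scalar f, exists v, f v != 0, K `<=` hyperplane f c
          & ~ hyperplane f c 0]
    & lattice_order_on (cone_span (cone_over K)) (cone_le (cone_over K))].

End Simplex.

HB.mixin Record isHilbert (R : realType) H & CompleteNormedModule R[i] H := {
  inner : H -> H -> R[i] ;
  inner_scalar : forall v, scalar (inner^~ v) ;
  innerC : forall u v, inner v u = Num.conj (inner u v) ;
  inner_norm : forall u, inner u u = `|u| ^+ 2
}.

#[short(type="hilbertType")]
HB.structure Definition Hilbert (R : realType) :=
  {H of isHilbert R H & CompleteNormedModule R[i] H}.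

Section BoundedOperators.
Context {R : realType} (H : hilbertType R).

Record bounded_op := BoundedOp {
  op_fun :> H -> H ;
  op_linear : linear op_fun ;
  op_bounded : exists k, forall u, `|op_fun u| <= k * `|u| }.

HB.instance Definition _ := gen_eqMixin bounded_op.
HB.instance Definition _ := gen_choiceMixin bounded_op.

Definition op_coef (T : bounded_op) : {ptws H * H -> R[i]} :=
  fun uv => inner (T uv.1) uv.2.

(* The weak operator topology: the coarsest one for which all the matrix
   coefficients [T |-> <T u, v>] are continuous. *)
Definition wot := initial_topology op_coef.

HB.instance Definition _ := Topological.on wot.

End BoundedOperators.

(* A von Neumann algebra on [H], i.e. a unital *-subalgebra of the bounded
   operators on [H] that is closed in the weak operator topology. [vn_op] is the
   inclusion; the C*-norm of [M] is then necessarily the operator norm. *)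
HB.mixin Record isVonNeumann (R : realType) (H : hilbertType R) M
    & CStarAlgebra R M := {
  vn_op : M -> bounded_op H ;
  vn_op_inj : injective vn_op ;
  vn_op_linear : forall (c : R[i]) x y u,
    vn_op (c *: x + y) u = c *: vn_op x u + vn_op y u ;
  vn_op1 : forall u, vn_op aone u = u ;
  vn_opM : forall x y u, vn_op (x ** y) u = vn_op x (vn_op y u) ;
  vn_op_star : forall x u v,
    inner (vn_op (star x) u) v = inner u (vn_op x v) ;
  vn_op_closed : closed (range vn_op : set (wot H))
}.

#[short(type="vonNeumannType")]
HB.structure Definition VonNeumann (R : realType) (H : hilbertType R) :=
  {M of isVonNeumann R H M & CStarAlgebra R M}.

Definition wot_dense (R : realType) (H : hilbertType R)
    (M : vonNeumannType H) (S : set M) :=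
  range (vn_op : M -> bounded_op H) `<=`
    closure ([set vn_op x | x in S] : set (wot H)).

Section Systems.
Context {R : realType} {G : groupType}.

Definition left_action (T : Type) (act : G -> T -> T) :=
  (forall x, act 1%g x = x) /\
  (forall g h x, act (g * h)%g x = act g (act h x)).

Definition cstar_system (A : cstarAlgType R) (Theta : G -> A -> A) :=
  left_action Theta /\ forall g, star_aut (Theta g).

Definition invariant_states (A : cstarAlgType R) (Theta : G -> A -> A) :
    set (sa_dual A) :=
  [set phi | is_state (phi : A -> R[i]) /\
             forall g a, phi (Theta g a) = phi a].

Definition uniquely_ergodic (A : cstarAlgType R) (Theta : G -> A -> A) :=
  exists phi, invariant_states Theta = [set phi].

Definition strictly_ergodic (A : cstarAlgType R) (Theta : G -> A -> A) :=
  exists phi, invariant_states Theta = [set phi] /\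
              faithful (phi : A -> R[i]).

Definition wstar_system (H : hilbertType R) (M : vonNeumannType H)
    (rho : M -> R[i]) (Xi : G -> M -> M) :=
  [/\ is_state rho, faithful rho, normal rho & tracial rho] /\
  [/\ left_action Xi, forall g, star_aut (Xi g)
    & forall g x, rho (Xi g x) = rho x].

(* [L] together with [Lambda] is the Hilbert space completion of [M] for the
   inner product [<x, y> = rho (y^* x)]. *)
Definition is_L2_completion (M : cstarAlgType R) (rho : M -> R[i])
    (L : hilbertType R) (Lambda : M -> L) :=
  [/\ linear Lambda, dense (range Lambda)
    & forall x y, inner (Lambda x) (Lambda y) = rho (star y ** x)].

Definition cstar_model (H : hilbertType R) (M : vonNeumannType H)
    (Xi : G -> M -> M) (A : cstarAlgType R) (Theta : G -> A -> A)
    (iota : A -> M) :=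
  [/\ cstar_system Theta, star_hom iota, wot_dense (range iota),
      forall g, [set Xi g x | x in range iota] = range iota
    & forall g a, Xi g (iota a) = iota (Theta g a)].

Definition faithful_cstar_model (H : hilbertType R) (M : vonNeumannType H)
    (Xi : G -> M -> M) (A : cstarAlgType R) (Theta : G -> A -> A)
    (iota : A -> M) :=
  cstar_model Xi Theta iota /\ injective iota.

End Systems.

Section Amenability.
Variables (R : realType) (G : groupType).

Definition bounded_real (f : G -> R) := exists k, forall g, `|f g| <= k.

(* Only the values of [m] on bounded functions matter. *)
Definition left_invariant_mean (m : (G -> R) -> R) :=
  [/\ forall c f h, bounded_real f -> bounded_real h ->
        m (fun x => c * f x + h x) = c * m f + m h,
      forall f, bounded_real f -> (forall g, 0 <= f g) -> 0 <= m f,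
      m (fun=> 1) = 1
    & forall g f, bounded_real f -> m (fun x => f (g * x)%g) = m f].

Definition amenable := exists m, left_invariant_mean m.

Definition fset_translate (E : {fset G}) (g : G) : {fset G} :=
  [fset (x * g)%g | x in E]%fset.

Definition symm_diff (D E : {fset G}) : {fset G} :=
  ((D `\` E) `|` (E `\` D))%fset.

Definition right_folner (F : nat -> {fset G}) :=
  (forall k, F k != fset0) /\
  (forall g, (fun k => (#|` symm_diff (fset_translate (F k) g) (F k)|)%:R /
                       (#|` F k|)%:R : R) @ \oo --> (0 : R)).

End Amenability.

Definition gauge (R : realType) (G : groupType) (A : cstarAlgType R)
    (Theta : G -> A -> A) (F : nat -> {fset G}) (a : A) : R[i] :=
  lim ((fun k => `|(#|` F k|)%:R^-1 *: \sum_(g <- F k) Theta g a| : R[i])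
       @ \oo).

(* Main.v *)
Require Import Defs.
From HB Require Import structures.
From mathcomp Require Import all_boot all_order all_algebra finmap complex.
From mathcomp Require Import ring lra.
From mathcomp Require Import all_classical all_reals all_analysis.

Set Implicit Arguments.
Unset Strict Implicit.
Unset Printing Implicit Defensive.

Import Order.TTheory GRing.Theory Num.Theory.
Import numFieldNormedType.Exports.

Local Open Scope classical_set_scope.
Local Open Scope ring_scope.
Local Open Scope complex_scope.

(** Composing the trace [rho] with [iota] gives an invariant state [tau] of [A]
    (unital because [iota] has weak operator dense range), and [tau] is faithful
    because [rho] is faithful and [iota] injective.  If [tau] is the only
    invariant state, the system is therefore strictly ergodic.

    If the gauge equals [tau] on positive elements, let [f] be an invariant
    state.  The value of [f] at a positive element [a] is its value at any
    average of the translates of [a], hence at most the norm of that average,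
    so [f a <= tau a] in the limit.  Applied to [c - x] with [c] a large scalar,
    this inequality reverses, and [f = tau]
    ([uniquely_ergodic_of_gauge]).

    The converse is a Hahn-Banach argument.  For self-adjoint [x], the largest
    element of the spectrum is the limit of [|x + t| - t] as [t] grows; this
    [spmax] is sublinear.  Replacing the norm of [x] by the upper limit of the
    norms of its averages gives an asymptotic version [spmax_sup].  A real
    functional dominated by [spmax_sup] defines a state, invariant because
    [spmax_sup] is at most zero on differences [Theta g x - x], by the Folner
    condition.  By Hahn-Banach such a state takes the value [spmax_sup a] at any
    prescribed self-adjoint [a] ([exists_invariant_state]).  Under unique
    ergodicity this value must be [tau a], also for [- a]; since the norm of a
    self-adjoint element is controlled by the spectral maxima of the element and
    of its opposite ([nrm_le_spmax]), the norms of the averages of a positive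
    [a] converge to [tau a] ([uniquely_ergodic_avg_cvg]).

    The C*-algebra theory used here is derived from the norm axioms alone,
    without spectra or functional calculus.  Its source is the square root of
    [1 - x] for self-adjoint [x] of norm less than one, a Banach fixed point
    ([sqrt1B]).  It yields the comparison of norm and spectral maximum, and
    Kaplansky's theorem that elements [b^* b] have nonnegative spectrum
    ([spmax_N_star_mul]), which is what makes functionals dominated by [spmax]
    positive. *)

(** * Sublinear functionals and the Hahn-Banach theorem *)

Section Sublinear.
Context {R : realType} {V : lmodType R}.
Implicit Types (p f : V -> R) (x y : V).

Definition sublinear p :=
  (forall x y, p (x + y) <= p x + p y) /\
  (forall c x, 0 <= c -> p (c *: x) = c * p x).

Lemma sublinear0 p : sublinear p -> p 0 = 0.
Proof. by move=> [_ pZ]; rewrite -(scale0r 0) pZ// mul0r. Qed.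

Lemma sublinear_ge p x : sublinear p -> - p (- x) <= p x.
Proof.
move=> sp; rewrite -subr_ge0 opprK.
by have := sp.1 x (- x); rewrite subrr sublinear0.
Qed.

(** For [c > 0] both [c] and its inverse scale [p], so the inequality applied
    twice is an equality. *)
Lemma sublinearP p : (forall x y, p (x + y) <= p x + p y) ->
  (forall c x, 0 < c -> p (c *: x) <= c * p x) -> sublinear p.
Proof.
move=> pD pZ; split=> // c x; rewrite le_eqVlt => /predU1P[<-|c0].
  have := pD 0 0; have := pZ 2^-1 0; rewrite scaler0 addr0 scale0r mul0r.
  by rewrite invr_gt0 ltr0n => /(_ isT); lra.
apply/eqP; rewrite eq_le pZ//=.
have := pZ c^-1 (c *: x); rewrite invr_gt0 => /(_ c0).
by rewrite scalerA mulVf ?gt_eqF// scale1r ler_pdivlMl.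
Qed.

Lemma sublinear_inf (S : V -> set R) :
  (forall x, S x !=set0) -> (forall x, has_lbound (S x)) ->
  (forall x y c d, S x c -> S y d -> exists2 e, S (x + y) e & e <= c + d) ->
  (forall k x c, 0 < k -> S x c -> S (k *: x) (k * c)) ->
  sublinear (fun x => inf (S x)).
Proof.
move=> S0 Sb SD SZ; apply: sublinearP => [x y|k x k0].
  apply/ler_addgt0Pr => e e0; have e2 : 0 < e / 2 by rewrite divr_gt0.
  have [c Sc cx] := inf_adherent e2 (conj (S0 x) (Sb x)).
  have [d Sd dy] := inf_adherent e2 (conj (S0 y) (Sb y)).
  have [f Sf fcd] := SD _ _ _ _ Sc Sd.
  by have := ge_inf (Sb _) Sf; lra.
rewrite -ler_pdivrMl//; apply: lb_le_inf => // c Sc.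
by rewrite ler_pdivrMl//; apply: ge_inf => //; exact: SZ.
Qed.

(** The largest sublinear functional below [p] that is at most [- p y] at
    [- y].  It serves twice: to force the linearity of a minimal functional, and,
    with [y] the unit of a C*-algebra, to extract spectral information from the
    norm. *)
Definition tighten p y x : R :=
  inf [set p (x + t *: y) - t * p y | t in [set t | 0 <= t]].

Section Tighten.
Variables (p : V -> R) (y : V).
Hypothesis sp : sublinear p.

Let tighten_lbound x :
  lbound [set p (x + t *: y) - t * p y | t in [set t | 0 <= t]] (- p (- x)).
Proof.
move=> _ [t /= t0 <-]; have := sp.1 (x + t *: y) (- x).
by rewrite addrAC subrr add0r sp.2//; lra.
Qed.

Lemma tighten_le t x : 0 <= t -> tighten p y x <= p (x + t *: y) - t * p y.
Proof.
move=> t0; apply: ge_inf; last by exists t.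
by exists (- p (- x)); exact: tighten_lbound.
Qed.

Lemma tighten_le_id x : tighten p y x <= p x.
Proof. by have := tighten_le x (lexx 0); rewrite scale0r mul0r addr0 subr0. Qed.

Lemma tightenN : tighten p y (- y) <= - p y.
Proof.
have := tighten_le (- y) ler01.
by rewrite scale1r addNr sublinear0// mul1r sub0r.
Qed.

Lemma tighten_lt x c : tighten p y x < c ->
  exists2 t, 0 <= t & p (x + t *: y) < c + t * p y.
Proof.
move/inf_lt => []; first by exists (p (x + 0 *: y) - 0 * p y), 0 => /=.
by move=> _ /= [t t0 <-] h; exists t => //; lra.
Qed.

Lemma tighten_sublinear : sublinear (tighten p y).
Proof.
apply: (@sublinear_inf (fun x =>
    [set p (x + t *: y) - t * p y | t in [set t | 0 <= t]])) => [x|x||].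
- by exists (p (x + 0 *: y) - 0 * p y), 0 => /=.
- by exists (- p (- x)); exact: tighten_lbound.
- move=> x z _ _ [s /= s0 <-] [t /= t0 <-].
  exists (p (x + z + (s + t) *: y) - (s + t) * p y).
    by exists (s + t) => //=; exact: addr_ge0.
  have := sp.1 (x + s *: y) (z + t *: y).
  by rewrite addrACA -scalerDl; lra.
- move=> k x _ k0 [t /= t0 <-]; exists (k * t); first by rewrite /= mulr_ge0// ltW.
  by rewrite -scalerA -scalerDr sp.2 1?ltW// mulrBr mulrA.
Qed.

End Tighten.

Lemma additive_of_tighten f : sublinear f ->
  (forall x y, f x <= tighten f y x) -> forall x y, f (x + y) = f x + f y.
Proof.
move=> sf ft x y; apply/eqP; rewrite eq_le sf.1/=.
have := le_trans (ft x y) (tighten_le y sf x ler01).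
by rewrite scale1r mul1r lerBrDr.
Qed.

(** A chain of sublinear functionals below [p] has its pointwise infimum as a
    lower bound, so Zorn's lemma applies to the reversed pointwise order. *)
Lemma exists_minimal_sublinear p : sublinear p ->
  exists f, [/\ sublinear f, forall x, f x <= p x &
    forall g, sublinear g -> (forall x, g x <= f x) -> g = f].
Proof.
move=> sp; pose T := {f : V -> R | sublinear f /\ forall x, f x <= p x}.
pose le (f g : T) := `[< forall x, sval g x <= sval f x >].
have lb (f : T) x : - p (- x) <= sval f x.
  apply: le_trans (sublinear_ge x (svalP f).1).
  by rewrite lerN2; exact: (svalP f).2.
have [|||C Ctot|[f [sf fp]] fmin] := @Zorn T le.
- by move=> f; apply/asboolP.
- move=> f g h /asboolP fg /asboolP gh; apply/asboolP => x.
  exact: le_trans (gh x) (fg x).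
- move=> [f Pf] [g Pg] /asboolP /= gf /asboolP /= fg.
  by apply: eq_exist; apply/funext => x; apply/le_anti; rewrite fg gf.
- have [->|/set0P[f0 Cf0]] := eqVneq C set0.
    by exists (exist _ p (conj sp (fun x => lexx _))).
  pose S x := [set sval f x | f in C].
  have Sb x : has_lbound (S x) by exists (- p (- x)) => _ [f Cf <-]; exact: lb.
  have S0 x : S x !=set0 by exists (sval f0 x), f0.
  have sS : sublinear (fun x => inf (S x)).
    apply: sublinear_inf => // [x y _ _ [f Cf <-] [g Cg <-]|k x _ k0 [f Cf <-]].
      have [/asboolP gf|/asboolP fg] := Ctot _ _ Cf Cg.
        exists (sval g (x + y)); first by exists g.
        by apply: le_trans ((svalP g).1.1 x y) _; rewrite lerD2r.
      exists (sval f (x + y)); first by exists f.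
      by apply: le_trans ((svalP f).1.1 x y) _; rewrite lerD2l.
    by exists f => //; rewrite (svalP f).1.2// ltW.
  have Sp x : inf (S x) <= p x.
    by apply: le_trans ((svalP f0).2 x); apply: ge_inf => //; exists f0.
  pose g : T := exist _ (fun x => inf (S x)) (conj sS Sp).
  exists g => f Cf; apply/asboolP => x /=.
  by apply: ge_inf => //; exists f.
- exists f; split=> // g sg gf.
  have gp x : g x <= p x by exact: le_trans (fp x).
  pose g' : T := exist _ g (conj sg gp).
  have /(fmin g') : le (exist _ f (conj sf fp)) g' by exact/asboolP.
  by case.
Qed.

(** Hahn-Banach: a minimal sublinear functional is unchanged by tightening in
    any direction, hence linear.  Tightening [p] at [y] first forces the value
    at [y]. *)
Theorem hahn_banach p y : sublinear p ->
  exists f, [/\ scalar f, forall x, f x <= p x & f y = p y].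
Proof.
move=> sp; have [f [sf fp fmin]] := exists_minimal_sublinear (tighten_sublinear y sp).
have fD : forall x z, f (x + z) = f x + f z.
  apply: additive_of_tighten => // x z.
  rewrite -[X in X x <= _](fmin (tighten f z))//; first exact: tighten_sublinear.
  exact: tighten_le_id.
have fN x : f (- x) = - f x.
  by apply/eqP; rewrite -addr_eq0 -fD addNr sublinear0.
have fZ c x : f (c *: x) = c * f x.
  have [c0|c0] := leP 0 c; first exact: sf.2.
  by rewrite -[c]opprK scaleNr fN sf.2 ?mulNr// oppr_ge0 ltW.
exists f; split=> [c x z|x|]; first by rewrite fD fZ.
  exact: le_trans (fp x) (tighten_le_id _ _ _).
apply/le_anti; rewrite (le_trans (fp y) (tighten_le_id _ _ _))//=.
by rewrite -lerN2 -fN (le_trans (fp _))// tightenN.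
Qed.

End Sublinear.

(** * Square roots in a C*-algebra *)

(** The algebra is allowed to be zero, hence the ring structure without the
    axiom [1 != 0]. *)
Section RingStructure.
Context {R : realType} (A : cstarAlgType R).

Let amul_addl : left_distributive (@amul R A) +%R.
Proof. by move=> x y z; have := amul_linearl z 1 x y; rewrite !scale1r. Qed.

Let amul_addr : right_distributive (@amul R A) +%R.
Proof. by move=> x y z; have := amul_linearr x 1 y z; rewrite !scale1r. Qed.

HB.instance Definition _ := GRing.Zmodule_isPzRing.Build (CStarAlgebra.sort A)
  amulA amul1x amulx1 amul_addl amul_addr.

End RingStructure.

Section Basics.
Context {R : realType} {A : cstarAlgType R}.
Implicit Types (x y z : A) (c : R[i]) (r : R).

Lemma cscalerAl c x y : c *: (x * y) = (c *: x) * y.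
Proof.
have := amul_linearl y c x 0.
by rewrite [amul 0 y](mul0r y) !addr0; exact: esym.
Qed.

Lemma cscalerAr c x y : c *: (x * y) = x * (c *: y).
Proof.
have := amul_linearr x c y 0.
by rewrite [amul x 0](mulr0 x) !addr0; exact: esym.
Qed.

Lemma star_mul x y : star (x * y) = star y * star x.
Proof. exact: starM. Qed.

Lemma star0 : star (0 : A) = 0.
Proof. by apply: (addrI (star 0)); rewrite -starD !addr0. Qed.

Lemma starN x : star (- x) = - star x.
Proof. by apply: (addrI (star x)); rewrite -starD !subrr star0. Qed.

Lemma starB x y : star (x - y) = star x - star y.
Proof. by rewrite starD starN. Qed.

Lemma star1 : star (1 : A) = 1.
Proof. by rewrite -[RHS]starK -[star 1 in RHS]mul1r star_mul starK mul1r. Qed.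

Lemma starZr r x : star (r%:C *: x) = r%:C *: star x.
Proof.
rewrite starZ; congr (_ *: _).
by apply/eqP; rewrite eq_complex /= oppr0 !eqxx.
Qed.

Lemma starZi x : star ('i *: x) = - ('i *: star x).
Proof.
rewrite starZ -scaleNr; congr (_ *: _).
by apply/eqP; rewrite eq_complex /= oppr0 !eqxx.
Qed.

Lemma scale_halfD x : (2^-1)%:C *: (x + x) = x.
Proof.
rewrite scalerDr -scalerDl -rmorphD.
have -> : 2^-1 + 2^-1 = 1 :> R by field.
by rewrite rmorph1 scale1r.
Qed.

(** The C*-norm takes values in the complex numbers; estimates are carried out
    on its real part. *)
Definition nrm x : R := complex.Re `|x|.

Lemma normE x : `|x| = (nrm x)%:C.
Proof. by rewrite /nrm RRe_real. Qed.

Lemma nrm_ge0 x : 0 <= nrm x.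
Proof. by rewrite -ler0c -normE normr_ge0. Qed.

Lemma nrmD x y : nrm (x + y) <= nrm x + nrm y.
Proof. by rewrite -lecR rmorphD /= -!normE ler_normD. Qed.

Lemma nrm0 : nrm 0 = 0.
Proof. by rewrite /nrm normr0. Qed.

Lemma nrm_eq0 x : nrm x = 0 -> x = 0.
Proof. by move=> x0; apply/eqP; rewrite -normr_eq0 normE x0. Qed.

Lemma nrmN x : nrm (- x) = nrm x.
Proof. by rewrite /nrm normrN. Qed.

Lemma nrmB x y : nrm (x - y) <= nrm x + nrm y.
Proof. by rewrite (le_trans (nrmD _ _))// nrmN. Qed.

Lemma nrm_distC x y : nrm (x - y) = nrm (y - x).
Proof. by rewrite -nrmN opprB. Qed.

Lemma nrmZ r x : nrm (r%:C *: x) = `|r| * nrm x.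
Proof.
apply: complexI; rewrite -normE normrZ normE rmorphM/=; congr (_ * _).
by rewrite normc_def /= expr0n addr0 sqrtr_sqr.
Qed.

Lemma nrmM x y : nrm (x * y) <= nrm x * nrm y.
Proof. by rewrite -lecR rmorphM /= -!normE normr_amul. Qed.

Lemma nrm_cstar x : nrm (star x * x) = nrm x ^+ 2.
Proof. by apply: complexI; rewrite rmorphXn /= -!normE cstar_identity. Qed.

Lemma nrm_star x : nrm (star x) = nrm x.
Proof.
suff le y : nrm y <= nrm (star y).
  by apply/le_anti; rewrite le andbT -[X in _ <= nrm X]starK le.
have [->|y0] := eqVneq (nrm y) 0; first exact: nrm_ge0.
rewrite -(@ler_pM2r _ (nrm y)) ?lt_neqAle ?nrm_ge0 1?eq_sym ?y0//.
by rewrite -expr2 -nrm_cstar nrmM.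
Qed.

Lemma nrm_sqr x : star x = x -> nrm (x * x) = nrm x ^+ 2.
Proof. by move=> sx; rewrite -nrm_cstar sx. Qed.

Lemma nrm1_le : nrm (1 : A) <= 1.
Proof.
have := nrm_sqr star1; rewrite mulr1 => /eqP.
rewrite -subr_eq0 -{1}[nrm 1]mulr1 expr2 -mulrBr mulf_eq0 subr_eq0.
by case/orP=> /eqP => [->|<-].
Qed.

Definition sc r : A := r%:C *: (1 : A).

Lemma scD r s : sc (r + s) = sc r + sc s.
Proof. by rewrite /sc rmorphD scalerDl. Qed.

Lemma scN r : sc (- r) = - sc r.
Proof. by rewrite /sc rmorphN scaleNr. Qed.

Lemma scB r s : sc (r - s) = sc r - sc s.
Proof. by rewrite scD scN. Qed.

Lemma sc1 : sc 1 = 1. Proof. by rewrite /sc scale1r. Qed.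

Lemma sc_mull r x : sc r * x = r%:C *: x.
Proof. by rewrite /sc -cscalerAl mul1r. Qed.

Lemma sc_mulr r x : x * sc r = r%:C *: x.
Proof. by rewrite /sc -cscalerAr mulr1. Qed.

Lemma scC r x : sc r * x = x * sc r.
Proof. by rewrite sc_mull sc_mulr. Qed.

Lemma scM r s : sc (r * s) = sc r * sc s.
Proof. by rewrite sc_mull /sc scalerA rmorphM. Qed.

Lemma star_sc r : star (sc r) = sc r.
Proof. by rewrite starZr star1. Qed.

Lemma nrm_sc_le r : nrm (sc r) <= `|r|.
Proof. by rewrite nrmZ ler_piMr// nrm1_le. Qed.

End Basics.

Section SquareRoot.
Context {R : realType} {A : cstarAlgType R}.
Implicit Types (x y z : A) (c : R[i]) (r : R).

Let le_of_geometric (a b k r : R) : 0 <= r < 1 ->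
  (forall n : nat, a <= b + k * r ^+ n) -> a <= b.
Proof.
move=> /andP[r0 r1] h.
have : (fun n => b + k * r ^+ n) @ \oo --> (b + k * 0 : R^o).
  apply: cvgD; first exact: cvg_cst.
  by apply: cvgM; [exact: cvg_cst|apply: cvg_expr; rewrite ger0_norm].
rewrite mulr0 addr0 => /cvgr_to_ge; apply.
by near=> n; exact: h.
Unshelve. all: by end_near. Qed.

Let nrm_squeeze x k r : 0 <= r < 1 ->
  (forall n : nat, nrm x <= k * r ^+ n) -> x = 0.
Proof.
move=> r01 h; apply: nrm_eq0; apply/le_anti; rewrite nrm_ge0 andbT.
by apply: (le_of_geometric r01) => n; rewrite add0r; exact: h.
Qed.

Lemma geometric_cvg (u : nat -> A) r : 0 <= r < 1 ->
  (forall n m : nat, (n <= m)%N -> nrm (u m - u n) <= r ^+ n) ->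
  exists y, forall n, nrm (y - u n) <= r ^+ n.
Proof.
move=> r01 h; have r1 : (fun n => r ^+ n) @ \oo --> (0 : R^o).
  by apply: cvg_expr; case/andP: r01 => r0 r1; rewrite ger0_norm.
have cu : cvg (u @ \oo).
  apply/cauchy_cvgP/cauchy_exP => e e0.
  have eE : e = (complex.Re e)%:C by rewrite RRe_real ?gtr0_real.
  have : 0 < complex.Re e by rewrite -ltcR -eE.
  move=> /(cvgr_lt (0 : R) r1)[N _ /(_ N (leqnn N)) rN].
  exists (u N), N => // m /= Nm.
  rewrite -ball_normE /= normE eE ltcR nrm_distC (le_lt_trans _ rN)//.
  exact: h.
exists (lim (u @ \oo)) => n; apply/ler_addgt0Pr => e e0.
have ec0 : (0 : R[i]) < e%:C by rewrite ltcR.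
have [N _ hN] := (cvgrPdist_lt _ _).1 cu _ ec0.
have := hN (maxn N n) (leq_maxl _ _); rewrite normE ltcR => h1.
have h2 := h n (maxn N n) (leq_maxr _ _).
rewrite -(subrKA (u (maxn N n))) (le_trans (nrmD _ _))// addrC lerD// ltW//.
Qed.

(** The Banach fixed point of [y |-> (x + y^2) / 2], started at [0]; the
    iterates, hence their limit, are self-adjoint and commute with everything
    that commutes with [x]. *)
Lemma sqrt1B x : star x = x -> nrm x < 1 ->
  exists y, [/\ star y = y, nrm y < 1, (1 - y) * (1 - y) = 1 - x &
    forall z, z * x = x * z -> z * y = y * z].
Proof.
move=> sx x1; pose f y := (2^-1)%:C *: (x + y * y).
(* [r] solves (|x| + r^2) / 2 = r, so that [f] maps the ball of radius [r] to
   itself. *)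
pose r := 1 - Num.sqrt (1 - nrm x).
have nx0 := nrm_ge0 x.
have s0 : 0 < Num.sqrt (1 - nrm x) by rewrite sqrtr_gt0 subr_gt0.
have s2 : Num.sqrt (1 - nrm x) ^+ 2 = 1 - nrm x by rewrite sqr_sqrtr// subr_ge0 ltW.
have r0 : 0 <= r by rewrite /r subr_ge0 -(ler_pXn2r (n:=2)) ?nnegrE ?sqrtr_ge0//; lra.
have r1 : r < 1 by rewrite /r; lra.
have rE : nrm x + r * r = 2 * r by move: s2; rewrite /r expr2; nra.
have f_ball y : nrm y <= r -> nrm (f y) <= r.
  move=> yr; rewrite nrmZ ger0_norm ?invr_ge0// ler_pdivrMl// -rE.
  rewrite (le_trans (nrmD _ _))// lerD2l (le_trans (nrmM _ _))//.
  by apply: ler_pM => //; exact: nrm_ge0.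
have f_contr y z : nrm y <= r -> nrm z <= r -> nrm (f y - f z) <= r * nrm (y - z).
  move=> yr zr; rewrite /f -scalerBr nrmZ ger0_norm ?invr_ge0// ler_pdivrMl//.
  have -> : x + y * y - (x + z * z) = y * (y - z) + (y - z) * z.
    by rewrite mulrBr mulrBl [RHS]addrA subrK opprD addrACA subrr add0r.
  have n0 := nrm_ge0 (y - z).
  rewrite (le_trans (nrmD _ _))//.
  have -> : 2 * (r * nrm (y - z)) = r * nrm (y - z) + nrm (y - z) * r by ring.
  by rewrite lerD// (le_trans (nrmM _ _))// ?ler_wpM2l ?ler_wpM2r.
pose u n := iter n f 0.
have u_ball n : nrm (u n) <= r.
  by elim: n => [|n IH]; rewrite ?nrm0//; exact: f_ball.
have [y uy] : exists y, forall n, nrm (y - u n) <= r ^+ n.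
  apply: geometric_cvg; first by rewrite r0.
  move=> n m /subnKC <-; move: (m - n)%N => k; elim: n => [|n IH].
    by rewrite subr0 (le_trans (u_ball _))// ltW.
  rewrite addSn /= exprS (le_trans (f_contr _ _ (u_ball _) (u_ball _)))//.
  exact: ler_wpM2l.
have r01 : 0 <= r < 1 by rewrite r0.
have yr : nrm y <= r.
  apply: (le_of_geometric (k := 1) r01) => n; rewrite mul1r addrC.
  by rewrite -(subrK (u n) y) (le_trans (nrmD _ _))// lerD.
exists y; split.
- apply/eqP; rewrite -subr_eq0; apply/eqP; apply: (nrm_squeeze (k := 2) r01) => // n.
  have su : star (u n) = u n.
    elim: n => [|n IH]; first exact: star0.
    by rewrite /u /= starZr starD sx star_mul IH.
  have -> : star y - y = star (y - u n) - (y - u n).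
    by rewrite starB su opprB addrA subrK.
  rewrite (le_trans (nrmB _ _))// nrm_star.
  by have := uy n; lra.
- exact: le_lt_trans r1.
- suff fy : y = f y.
    have : y + y = x + y * y.
      by rewrite {1 2}fy -scalerDr scale_halfD.
    move=> e; have -> : x = y + y - y * y by rewrite e addrK.
    by rewrite mulrBl mul1r mulrBr mulr1 -[in RHS]addrA [in RHS]opprD [in RHS]addrA.
  apply/eqP; rewrite -subr_eq0; apply/eqP; apply: (nrm_squeeze (k := 2) r01) => // n.
  have -> : y - f y = (y - u n.+1) + (f (u n) - f y) by rewrite addrA subrK.
  rewrite (le_trans (nrmD _ _))//.
  have := f_contr _ _ (u_ball n) yr; rewrite nrm_distC.
  have := uy n; have := uy n.+1; have := nrm_ge0 (u n - y).
  rewrite exprS (nrm_distC (u n)).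
  have : 0 <= r ^+ n by exact: exprn_ge0.
  by nra.
- move=> z zx; apply/eqP; rewrite -subr_eq0; apply/eqP.
  apply: (nrm_squeeze (k := 2 * nrm z) r01) => // n.
  have zu : z * u n = u n * z.
    elim: n => [|n IH]; first by rewrite mulr0 mul0r.
    rewrite /u /= -/(u n) /f -cscalerAr -cscalerAl mulrDr mulrDl zx.
    by rewrite mulrA IH -!mulrA IH.
  have -> : z * y - y * z = z * (y - u n) - (y - u n) * z.
    by rewrite mulrBr mulrBl zu opprB addrA subrK.
  rewrite (le_trans (nrmB _ _))//.
  have := nrmM z (y - u n); have := nrmM (y - u n) z.
  have := ler_wpM2l (nrm_ge0 z) (uy n).
  by nra.
Qed.

End SquareRoot.

(** * The spectral maximum *)

(** The algebra with its scalars restricted to the real numbers. *)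
Definition realified (R : realType) (A : cstarAlgType R) : Type := A.

Section Realified.
Context {R : realType} (A : cstarAlgType R).

HB.instance Definition _ := GRing.Zmodule.copy (realified A) A.

Let scale (r : R) (x : realified A) : realified A := r%:C *: (x : A).

Let scaleA r s x : scale r (scale s x) = scale (r * s) x.
Proof. by rewrite /scale scalerA rmorphM. Qed.

Let scale1 : left_id 1 scale.
Proof. by move=> x; rewrite /scale rmorph1 scale1r. Qed.

Let scaleDr : right_distributive scale +%R.
Proof. by move=> r x y; rewrite /scale scalerDr. Qed.

Let scaleDl x : {morph scale^~ x : r s / r + s}.
Proof. by move=> r s; rewrite /scale rmorphD scalerDl. Qed.

HB.instance Definition _ := GRing.Zmodule_isLmodule.Build R (realified A)
  scaleA scale1 scaleDr scaleDl.

Lemma realified_scaleE (r : R) (x : realified A) : r *: x = r%:C *: (x : A).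
Proof. by []. Qed.

End Realified.

Section SquareRoots.
Context {R : realType} {A : cstarAlgType R}.
Implicit Types (x y z p q : A) (c r t : R).

(** [sqrt1B] rescaled by [c].  The bound on the distance from [s] to the
    scalar [Num.sqrt c] says that [s] is positive and allows taking the square
    root of [s] in turn. *)
Lemma sqrt_scB x c : star x = x -> nrm x < c ->
  exists s, [/\ star s = s, nrm (sc (Num.sqrt c) - s) < Num.sqrt c,
    s * s = sc c - x & forall z, z * x = x * z -> z * s = s * z].
Proof.
move=> sx xc; have c0 : 0 < c by exact: le_lt_trans (nrm_ge0 _) xc.
have rc0 : 0 < Num.sqrt c by rewrite sqrtr_gt0.
have [|| y [sy y1 y2 yC]] := @sqrt1B R A ((c^-1)%:C *: x).
- by rewrite starZr sx.
- by rewrite nrmZ ger0_norm ?invr_ge0 ?ltW// ltr_pdivrMl// mulr1.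
exists ((Num.sqrt c)%:C *: (1 - y)); split.
- by rewrite starZr starB star1 sy.
- rewrite /sc -scalerBr opprB addrC subrK nrmZ ger0_norm ?ltW//.
  by rewrite gtr_pMr.
- rewrite -cscalerAr -cscalerAl y2 scalerA -rmorphM -expr2 sqr_sqrtr ?ltW//.
  by rewrite scalerBr scalerA -rmorphM divff ?gt_eqF// rmorph1 scale1r.
- move=> z zx; rewrite -cscalerAr -cscalerAl mulrBr mulrBl mul1r mulr1 yC//.
  by rewrite -cscalerAr -cscalerAl zx.
Qed.

(** [star (p + i q) * (p + i q) = p^2 + q^2] when [p] and [q] commute. *)
Lemma nrm_pythagoras p q c : star p = p -> star q = q -> p * q = q * p ->
  0 <= c -> p * p + q * q = sc (c ^+ 2) -> nrm p <= c.
Proof.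
move=> sp sq pq c0 E; set u := p + 'i *: q.
have si : star ('i *: q) = - ('i *: q) by rewrite starZi sq.
have ii : 'i%C * 'i%C = -1 :> R[i] by rewrite -expr2 sqr_i.
have uE : star u * u = sc (c ^+ 2).
  have pw : p * ('i *: q) = 'i *: q * p by rewrite -cscalerAr -cscalerAl pq.
  rewrite starD sp si mulrBl !mulrDr pw opprD addrA addrK.
  by rewrite -cscalerAl -cscalerAr scalerA ii scaleN1r opprK E.
have uc : nrm u <= c.
  rewrite -(ler_pXn2r (n:=2)) ?nnegrE ?nrm_ge0// -nrm_cstar uE.
  by rewrite (le_trans (nrm_sc_le _))// ger0_norm// sqr_ge0.
have -> : p = (2^-1)%:C *: (u + star u).
  by rewrite starD sp si addrACA subrr addr0 scale_halfD.
rewrite nrmZ ger0_norm ?invr_ge0// ler_pdivrMl//.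
by rewrite (le_trans (nrmD _ _))// nrm_star; lra.
Qed.

(** [sc t - x^2] is the square of some [s] that commutes with [x], and
    [s^2 + x^2 = t] bounds [s]. *)
Lemma nrm_scB_sqr x t : star x = x -> nrm x ^+ 2 < t -> nrm (sc t - x * x) <= t.
Proof.
move=> sx xt; have t0 : 0 < t by exact: le_lt_trans (sqr_ge0 _) xt.
have [|| s [ss _ s2 sC]] := @sqrt_scB (x * x) t.
- by rewrite star_mul sx.
- by rewrite nrm_sqr.
rewrite -s2 nrm_sqr// -[leRHS](sqr_sqrtr (ltW t0)).
rewrite ler_pXn2r ?nnegrE ?nrm_ge0 ?sqrtr_ge0//.
apply: (@nrm_pythagoras s x) => //; rewrite ?sqrtr_ge0//.
  by rewrite sC ?mulrA.
by rewrite s2 subrK sqr_sqrtr ?ltW.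
Qed.

End SquareRoots.

Section SpectralMaximum.
Context {R : realType} {A : cstarAlgType R}.
Implicit Types (x y z b d p q : A) (c r t : R).

(** For self-adjoint [x] this is the largest element of the spectrum, obtained
    from the norm alone: [|x + t| - t] decreases to it as [t] grows. *)
Definition spmax x : R := tighten (nrm : realified A -> R) (1 : A) x.

Lemma nrm_sublinear : sublinear (nrm : realified A -> R).
Proof.
by split=> [x y|r x r0]; [exact: nrmD|rewrite nrmZ ger0_norm].
Qed.

Hypothesis A_neq0 : (1 : A) != 0.

Lemma nrm1 : nrm (1 : A) = 1.
Proof.
have n0 : nrm (1 : A) != 0.
  by apply/eqP => /nrm_eq0 /eqP; rewrite (negPf A_neq0).
by apply: (mulfI n0); rewrite mulr1 -expr2 -nrm_sqr ?star1 ?mulr1.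
Qed.

Lemma spmax_le t x : 0 <= t -> spmax x <= nrm (x + sc t) - t.
Proof.
move=> t0.
have := @tighten_le R (realified A) nrm (1 : A) nrm_sublinear t x t0.
by rewrite nrm1 mulr1.
Qed.

Lemma spmax_lt x c : spmax x < c -> exists2 t, 0 <= t & nrm (x + sc t) < c + t.
Proof.
move=> /(@tighten_lt R (realified A) nrm 1)[t t0].
by rewrite nrm1 mulr1; exists t.
Qed.

Lemma spmax_le_nrm x : spmax x <= nrm x.
Proof. exact: (@tighten_le_id R (realified A) nrm 1 nrm_sublinear x). Qed.

Lemma spmax_sublinear : sublinear (spmax : realified A -> R).
Proof. exact: (@tighten_sublinear R (realified A) nrm 1 nrm_sublinear). Qed.

Lemma spmaxD x y : spmax (x + y) <= spmax x + spmax y.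
Proof. exact: spmax_sublinear.1. Qed.

Lemma spmaxZ r x : 0 <= r -> spmax (r%:C *: x) = r * spmax x.
Proof. exact: (spmax_sublinear.2 r x). Qed.

Lemma spmax_sc r : spmax (sc r) <= r.
Proof.
have rr : 0 <= r + `|r| by have := ler_norm (- r); rewrite normrN; lra.
have := spmax_le (sc r) (normr_ge0 r); rewrite -scD.
have := nrm_sc_le (A := A) (r + `|r|); rewrite (ger0_norm rr); lra.
Qed.

Lemma spmax_N_sqr x : star x = x -> spmax (- (x * x)) <= 0.
Proof.
move=> sx; set t := nrm x ^+ 2 + 1.
have t0 : 0 <= t by rewrite /t addr_ge0// sqr_ge0.
have := spmax_le (- (x * x)) t0; rewrite [_ + sc t]addrC.
have xt : nrm x ^+ 2 < t by rewrite /t; lra.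
by have := nrm_scB_sqr sx xt; lra.
Qed.

(** The spectral radius formula for self-adjoint elements.  If [x] and [- x]
    both stay below [c], then [c - x] and [c + x] are squares of commuting
    elements [w] and [v], so that [x^2 + (w v)^2 = c^2]. *)
Lemma nrm_le_spmax x c : star x = x ->
  spmax x <= c -> spmax (- x) <= c -> nrm x <= c.
Proof.
move=> sx xc0 nxc0; apply/ler_addgt0Pr => e e0.
have xc : spmax x < c + e by rewrite (le_lt_trans xc0)// ltrDl.
have nxc : spmax (- x) < c + e by rewrite (le_lt_trans nxc0)// ltrDl.
move: {c e e0 xc0 nxc0}(c + e) xc nxc => c xc nxc.
have [s s0 xs] := spmax_lt xc.
have [t t0 xt] := spmax_lt nxc.
have c0 : 0 <= c.
  by have := spmaxD x (- x); rewrite subrr [spmax 0](sublinear0 spmax_sublinear); lra.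
set T := s + t; have T0 : 0 <= T by rewrite addr_ge0.
have xT : nrm (x + sc T) < T + c.
  rewrite scD addrA (le_lt_trans (nrmD _ _))//.
  by have := nrm_sc_le (A := A) t; rewrite ger0_norm// /T; lra.
have nxT : nrm (- x + sc T) < T + c.
  rewrite /T addrC scD addrAC -addrA (le_lt_trans (nrmD _ _))//.
  have := nrm_sc_le (A := A) s; rewrite ger0_norm//.
  by move: xt; rewrite [- x + _]addrC; lra.
have sxT y : star y = y -> star (y + sc T) = y + sc T.
  by move=> sy; rewrite starD sy star_sc.
have [w [sw _ w2 wC]] := sqrt_scB (sxT _ sx) xT.
have [|v [sv _ v2 vC]] := sqrt_scB (sxT (- x) _) nxT; first by rewrite starN sx.
have w2' : w * w = sc c - x.
  by rewrite w2 scD [sc T + _]addrC [x + _]addrC opprD addrA addrK.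
have v2' : v * v = sc c + x.
  by rewrite v2 scD [sc T + _]addrC [- x + _]addrC opprD addrA addrK opprK.
have xw : x * w = w * x by apply: wC; rewrite mulrDr mulrDl scC.
have xv : x * v = v * x by apply: vC; rewrite mulrDr mulrDl scC mulrN mulNr.
have vw : v * w = w * v by apply: wC; rewrite mulrDr mulrDl scC xv.
apply: (@nrm_pythagoras _ _ x (v * w)) => //.
- by rewrite star_mul sv sw.
- by rewrite mulrA xv -!mulrA xw.
- have -> : v * w * (v * w) = v * v * (w * w) by rewrite mulrA -(mulrA v w) -vw !mulrA.
  rewrite v2' w2' mulrDl !mulrBr -scM -[c * c]expr2 scC [X in _ + X]addrA subrK.
  by rewrite addrCA subrr addr0.
Qed.

End SpectralMaximum.

(** * Positivity of elements of the form [b^* b] *)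

Section Kaplansky.
Context {R : realType} {A : cstarAlgType R}.
Implicit Types (x y z b d p q : A) (c r t e : R).
Hypothesis A_neq0 : (1 : A) != 0.

(** With [X = d d^*] and [Y = d^* d], the identity
    [2 l X + X^2 = d (2 l + Y) d^*] bounds [(l + X)^2] by
    [l^2 + |d|^2 (2 l + e)], whereas [|l + X|] is at least [l + |d|^2] unless
    [|d|^2] is already at most [e].  This replaces the fact that [d^* d] and
    [d d^*] have the same nonzero spectrum. *)
Lemma sqr_nrm_le_spmax d e : 0 <= e ->
  spmax (star d * d) <= e -> spmax (- (d * star d)) <= e -> nrm d ^+ 2 <= e.
Proof.
move=> e0 Ye Xe; rewrite leNgt; apply/negP => de.
have [l lE] : exists l, nrm d ^+ 2 = l by eexists.
rewrite lE in de.
have l0 : 0 <= l by rewrite -lE sqr_ge0.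
set Y := star d * d in Ye; set X := d * star d in Xe.
have sX : star X = X by rewrite star_mul starK.
have sY : star Y = Y by rewrite star_mul starK.
have nY : nrm Y = l by rewrite nrm_cstar lE.
have nX : nrm X = l by rewrite /X -[X in X * _]starK nrm_cstar nrm_star lE.
have Xl : l <= nrm (X + sc l) - l.
  rewrite -[leLHS]nX; apply: le_trans (spmax_le A_neq0 X l0).
  apply: nrm_le_spmax => //; apply: (le_trans Xe).
  rewrite leNgt; apply/negP => Xe'; move: de; rewrite -nX ltNge.
  by rewrite nrm_le_spmax// ltW.
have Y2 : nrm (sc (2 * l) + Y) <= 2 * l + e.
  apply: nrm_le_spmax => //.
  - by rewrite starD star_sc sY.
  - by rewrite (le_trans (spmaxD _ _))// lerD// spmax_sc.
  - rewrite opprD -scN (le_trans (spmaxD _ _))//.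
    have := spmax_sc A_neq0 (- (2 * l)); have := spmax_le_nrm (- Y).
    by rewrite nrmN nY; lra.
have XY : (X + sc l) * (X + sc l) = d * (sc (2 * l) + Y) * star d + sc (l * l).
  have -> : d * (sc (2 * l) + Y) * star d = sc l * X + sc l * X + X * X.
    by rewrite mulr_natl mulr2n scD mulrDr mulrDr mulrDl mulrDl -!scC !mulrA.
  rewrite mulrDl !mulrDr -(scC l X) -scM addrA; congr (_ + _).
  by rewrite -addrA addrC.
have : nrm (X + sc l) ^+ 2 <= l * (2 * l + e) + l * l.
  rewrite -nrm_sqr ?starD ?sX ?star_sc// XY (le_trans (nrmD _ _))// lerD//.
    rewrite (le_trans (nrmM _ _))// nrm_star.
    have -> : l * (2 * l + e) = nrm d * (2 * l + e) * nrm d by rewrite -lE; ring.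
    rewrite ler_wpM2r ?nrm_ge0// (le_trans (nrmM _ _))//.
    by rewrite ler_wpM2l ?nrm_ge0.
  by rewrite (le_trans (nrm_sc_le _))// ger0_norm// mulr_ge0.
have : (2 * l) ^+ 2 <= nrm (X + sc l) ^+ 2.
  by rewrite ler_pXn2r ?nnegrE ?nrm_ge0 ?mulr_ge0//; lra.
by nra.
Qed.

(** [k^2] is the square root of [x^2 + e], which approximates the modulus of
    [x]; the shift by [e] makes the square root available.  The further root
    [k] exhibits [n k^2 n] as a square when [n] commutes with [k]. *)
Lemma approx_modulus x e : star x = x -> 0 < e ->
  exists k, [/\ star k = k, k * k * (k * k) = x * x + sc e & x * k = k * x].
Proof.
move=> sx e0; set c := nrm x ^+ 2 + 1 + e.
have xc : nrm (sc (c - e) - x * x) < c.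
  have xce : nrm x ^+ 2 < c - e by rewrite /c; lra.
  by rewrite (le_lt_trans (nrm_scB_sqr sx xce))//; lra.
have [|m [sm mc mm mC]] := sqrt_scB _ xc.
  by rewrite starB star_sc star_mul sx.
have [|k [sk _ kk kC]] := sqrt_scB _ mc.
  by rewrite starB star_sc sm.
have {}kk : k * k = m by rewrite kk opprB addrC subrK.
exists k; split=> //.
  by rewrite kk mm scB opprB addrCA subKr.
have xm : x * m = m * x by apply: mC; rewrite mulrBr mulrBl scC mulrA.
by apply: kC; rewrite mulrBr mulrBl scC xm.
Qed.

Lemma nrm_cube x : star x = x -> nrm x ^+ 3 <= nrm (x * x * x).
Proof.
move=> sx; have [->|x0] := eqVneq (nrm x) 0; first by rewrite expr0n nrm_ge0.
have {}x0 : 0 < nrm x by rewrite lt_neqAle eq_sym x0 nrm_ge0.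
rewrite -(ler_pM2r x0) -exprSr (exprM _ 2 2).
rewrite -(nrm_sqr sx) -nrm_sqr ?star_mul ?sx// mulrA; exact: nrmM.
Qed.

(** Kaplansky's theorem that [b^* b] has nonnegative spectrum.  For
    [x = b^* b] and [m] the square root of [x^2 + e], the element [n = m - x]
    is about twice the negative part of [x].  Then [d = b n] has
    [d^* d = n x n] at most [e |n|], and as [d^* d + d d^*] is a sum of
    squares, [- d d^*] is at most that as well; so [|d^* d| <= e |n|].  Since
    [n (n + 2 x) = e], the cube [n^3 = e n - 2 d^* d] is small, and
    [- x = n - m] has spectral maximum at most [|n|]. *)
Theorem spmax_N_star_mul b : spmax (- (star b * b)) <= 0.
Proof.
have [x xE] : exists x, star b * b = x by eexists.
have sx : star x = x by rewrite -xE star_mul starK.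
rewrite xE.
rewrite leNgt; apply/negP; set mu := spmax (- x) => mu0.
(* The argument gives [mu <= |n|] and [|n|^2 <= 3 e], a contradiction for this
   value of [e]. *)
pose e := mu ^+ 2 / 6; have e0 : 0 < e by rewrite divr_gt0// exprn_gt0.
have [k [sk k4 xk]] := approx_modulus sx e0.
have [m mE] : exists m, k * k = m by eexists.
rewrite mE in k4; have [n nD] : exists n, n = m - x by eexists.
have sm : star m = m by rewrite -mE star_mul sk.
have sn : star n = n by rewrite nD starB sm sx.
have xm : x * m = m * x by rewrite -mE mulrA xk -!mulrA xk.
have nk : n * k = k * n by rewrite nD mulrBl mulrBr xk -mE mulrA.
have nE : n * n + n * x + n * x = sc e.
  have nx : n + x *+ 2 = m + x by rewrite nD mulr2n addrA subrK.
  rewrite -addrA -mulr2n -mulrnAr -mulrDr nx.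
  by rewrite nD mulrDr !mulrBl k4 xm addrA subrK addrAC subrr add0r.
set d := b * n.
have dd : star d * d = n * x * n by rewrite star_mul sn -xE !mulrA.
have ddE : star d * d = sc e * n - n * k * (n * k).
  rewrite dd -nE !mulrDl; have -> : n * k * (n * k) = n * n * n + n * x * n.
    have xn : n * x = x * n by rewrite nD mulrBl mulrBr xm.
    rewrite mulrA -(mulrA n k n) -nk !mulrA -(mulrA (n * n)) mE.
    have -> : m = n + x by rewrite nD subrK.
    by rewrite mulrDr; congr (_ + _); rewrite -mulrA [in LHS]xn mulrA.
  by rewrite addrAC subrr add0r.
have n0 := nrm_ge0 n.
have en0 : 0 <= e * nrm n by rewrite mulr_ge0// ltW.
have snk : star (n * k) = n * k by rewrite star_mul sn sk nk.
have dd_le : spmax (star d * d) <= e * nrm n.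
  rewrite ddE (le_trans (spmaxD _ _))// -[leRHS]addr0 lerD ?spmax_N_sqr//.
  by rewrite (le_trans (spmax_le_nrm _))// sc_mull nrmZ gtr0_norm.
have dd_ge : spmax (- (d * star d)) <= e * nrm n.
  set P := d + star d; set Q := 'i *: (d - star d).
  have sP : star P = P by rewrite starD starK addrC.
  have sQ : star Q = Q by rewrite /Q starZi starB starK -scalerN opprB.
  have double v : 2%:C *: v = v + v :> A.
    by rewrite -[2]/(1 + 1) rmorphD rmorph1 scalerDl scale1r.
  have QQ : Q * Q = - ((d - star d) * (d - star d)).
    by rewrite -cscalerAl -cscalerAr scalerA -expr2 sqr_i scaleN1r.
  have PQ : P * P + Q * Q = d * star d + d * star d + (star d * d + star d * d).
    rewrite QQ mulrDl mulrBl !mulrDr !mulrN.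
    move: (d * d) (d * star d) (star d * d) (star d * star d) => u v w z.
    rewrite opprB [X in _ + X]addrC addrACA opprB.
    by rewrite (addrC u) [X in X + _]addrACA [X in _ + X]addrACA !subrr !addr0.
  have {}PQ : 2%:C *: - (d * star d) = 2%:C *: (star d * d) - P * P - Q * Q.
    by rewrite !double -addrA -[in RHS]opprD PQ [in RHS]opprD addrCA subrr addr0 opprD.
  have := spmaxZ (- (d * star d)) (ler0n R 2).
  have := spmaxZ (star d * d) (ler0n R 2).
  have := spmaxD (2%:C *: (star d * d) - P * P) (- (Q * Q)).
  have := spmaxD (2%:C *: (star d * d)) (- (P * P)).
  have := spmax_N_sqr A_neq0 sP; have := spmax_N_sqr A_neq0 sQ.
  by rewrite -PQ; lra.
have nd : nrm (n * x * n) <= e * nrm n.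
  by rewrite -dd nrm_cstar; exact: sqr_nrm_le_spmax.
have n3 : nrm n ^+ 3 <= 3 * e * nrm n.
  rewrite (le_trans (nrm_cube sn))//.
  have -> : n * n * n = sc e * n - n * x * n - n * x * n.
    by rewrite -nE !mulrDl !addrK.
  have := nrmB (sc e * n - n * x * n) (n * x * n).
  have := nrmB (sc e * n) (n * x * n).
  by rewrite sc_mull nrmZ gtr0_norm//; lra.
have mun : mu <= nrm n.
  have -> : mu = spmax (n + - m) by rewrite nD addrAC subrr add0r.
  rewrite (le_trans (spmaxD _ _))// -[leRHS]addr0 -mE.
  by rewrite lerD ?spmax_le_nrm ?spmax_N_sqr.
have n_gt0 : 0 < nrm n by exact: lt_le_trans mun.
move: n3; rewrite exprSr ler_pM2r// /e leNgt => /negP; apply.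
have : mu ^+ 2 <= nrm n ^+ 2 by rewrite ler_pXn2r ?nnegrE// ltW.
by have := exprn_gt0 2 mu0; lra.
Qed.

End Kaplansky.

(** * States *)

Section States.
Context {R : realType} {A : cstarAlgType R}.
Implicit Types (a b x y z : A) (c r t : R).

Lemma positive_star x : positive x -> star x = x.
Proof. by case=> b ->; rewrite starM starK. Qed.

Lemma cartesian x : exists p q, [/\ star p = p, star q = q & x = p + 'i *: q].
Proof.
exists ((2^-1)%:C *: (x + star x)), ((2^-1)%:C *: ('i *: (star x - x))); split.
- by rewrite starZr starD starK addrC.
- by rewrite starZr starZi starB starK -scalerN opprB.
- rewrite !scalerA mulrAC -expr2 sqr_i mulN1r scaleNr -scalerN opprB -scalerDr.
  by rewrite addrACA subrr addr0 scale_halfD.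
Qed.

Lemma scalar_eq_on_sa (f g : A -> R[i]) : scalar f -> scalar g ->
  (forall x, star x = x -> f x = g x) -> f = g.
Proof.
move=> fl gl fg; apply/funext => x; have [p [q [sp sq ->]]] := cartesian x.
by rewrite addrC fl gl !fg.
Qed.

Section State.
Variable f : A -> R[i].
Hypothesis sf : is_state f.

Let f_scalar : scalar f. Proof. by case: sf. Qed.
Let f_ge0 b : 0 <= f (star b * b). Proof. by case: sf => _ + _; apply; exists b. Qed.

Lemma state1 : f 1 = 1. Proof. by case: sf. Qed.

Lemma stateD x y : f (x + y) = f x + f y.
Proof. by have := f_scalar 1 x y; rewrite scale1r mul1r. Qed.

Lemma state0 : f 0 = 0.
Proof. by apply: (addrI (f 0)); rewrite -stateD !addr0. Qed.

Lemma stateZ (k : R[i]) x : f (k *: x) = k * f x.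
Proof. by have := f_scalar k x 0; rewrite !addr0 state0 addr0. Qed.

Lemma stateN x : f (- x) = - f x.
Proof. by rewrite -scaleN1r stateZ mulN1r. Qed.

Lemma state_sc r : f (sc r) = r%:C.
Proof. by rewrite stateZ state1 mulr1. Qed.

(** The values at [(x + 1)^* (x + 1)] and [(x + i)^* (x + i)] are real. *)
Lemma state_star x : f (star x) = Num.conj (f x).
Proof.
have := f_ge0 (x + 'i *: (1 : A)); have := f_ge0 (x + 1); have := f_ge0 x.
rewrite !starD starZ star1 !mulrDl !mulrDr !mulr1 !mul1r.
rewrite -!cscalerAl -!cscalerAr !mulr1 !mul1r !stateD !stateZ state1.
case: (f x) (f (star x)) (f (star x * x)) => [u1 u2] [v1 v2] [w1 w2].
rewrite !lecE /= => /andP[/eqP w0 _] /andP[/eqP e1 _] /andP[/eqP e2 _].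
by apply/eqP; rewrite eq_complex /=; apply/andP; split; apply/eqP; lra.
Qed.

Lemma state_sa_le x : star x = x -> f x <= (nrm x)%:C.
Proof.
move=> sx; have fx c : nrm x < c -> f x <= c%:C.
  move=> xc; have [s [ss _ s2 _]] := sqrt_scB sx xc.
  rewrite -subr_ge0 -(state_sc c) -stateN -stateD -s2 -{1}ss; exact: f_ge0.
have {}fx e : 0 < e -> f x <= (nrm x + e)%:C by move=> e0; rewrite fx// ltrDl.
move: fx; case: (f x) => u v fx; rewrite lecE /=; apply/andP; split.
  by have := fx 1 ltr01; rewrite lecE /= => /andP[].
by apply/ler_addgt0Pr => e /fx; rewrite lecE /= => /andP[].
Qed.

Lemma state_cauchy_schwarz x : `|f x| ^+ 2 <= f (star x * x).
Proof.
have := f_ge0 (x - f x *: (1 : A)); rewrite starB starZ star1 mulrBl !mulrBr.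
rewrite -!cscalerAl -!cscalerAr mulr1 !mul1r.
rewrite !(stateD, stateN, stateZ) state1 mulr1 state_star normCK.
rewrite [Num.conj (f x) * f x]mulrC subrr subr0 => h.
by rewrite -subr_ge0.
Qed.

Lemma state_le_norm x : `|f x| <= `|x|.
Proof.
rewrite -(@ler_pXn2r _ 2)// ?nnegrE ?normr_ge0//.
apply: le_trans (state_cauchy_schwarz x) _.
rewrite (le_trans (state_sa_le _))//; first by rewrite star_mul starK.
by rewrite nrm_cstar rmorphXn /= -normE.
Qed.

Lemma state_sa_functional : is_sa_functional f.
Proof.
split=> //; last exact: state_star.
by exists 1 => x; rewrite mul1r state_le_norm.
Qed.

End State.

Definition sa_of_state (f : A -> R[i]) (sf : is_state f) : sa_dual A :=
  SaDual (asboolT (state_sa_functional sf)).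

End States.

Section StarHom.
Context {R : realType} {A B : cstarAlgType R}.

(** For [c > |a|^2] a square root [s] of [c - a^* a] has
    [f a^* f a + (f s)^2 = c], so the spectrum of [f a^* f a] lies in [[0, c]]. *)
Lemma star_hom_contractive (f : A -> B) (a : A) : (1 : B) != 0 ->
  star_hom f -> f 1 = 1 -> nrm (f a) <= nrm a.
Proof.
move=> B1 [fl fM fs] f1.
have fB x y : f (x - y) = f x - f y.
  by rewrite addrC -scaleN1r fl scaleN1r addrC.
have f0 : f 0 = 0 by rewrite -(subrr 0) fB subrr.
have fsc r : f (sc r) = sc r by rewrite /sc -[_ *: _]addr0 fl f0 addr0 f1.
rewrite -(ler_pXn2r (n:=2)) ?nnegrE ?nrm_ge0//.
apply/ler_addgt0Pr => e e0.
have ac : nrm (star a * a) < nrm a ^+ 2 + e by rewrite nrm_cstar ltrDl.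
have [|s [ss _ s2 _]] := sqrt_scB _ ac; first by rewrite star_mul starK.
have sfa : star (star (f a) * f a) = star (f a) * f a by rewrite star_mul starK.
have sfs : star (f s) = f s by rewrite -fs ss.
rewrite -nrm_cstar; apply: nrm_le_spmax => //.
  have -> : star (f a) * f a = sc (nrm a ^+ 2 + e) + - (f s * f s).
    have -> : f s * f s = f (s * s) by exact: esym (fM s s).
    rewrite s2 fB fsc opprB addrC subrK -[star (f a)]fs; exact: esym (fM _ _).
  rewrite (le_trans (spmaxD _ _))// -[leRHS]addr0 lerD ?spmax_sc//.
  exact: spmax_N_sqr.
by rewrite (le_trans (spmax_N_star_mul B1 (f a)))// addr_ge0 ?sqr_ge0// ltW.
Qed.

End StarHom.

Section RealFunctional.
Context {R : realType} {A : cstarAlgType R}.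

(** A real functional dominated by the spectral maximum is nonpositive at
    [- b^* b] and equals [1] at the unit; its values at self-adjoint elements
    extend complex-linearly. *)
Lemma state_of_spmax (l : realified A -> R) : (1 : A) != 0 ->
  scalar l -> (forall x : A, l x <= spmax x) ->
  exists f : A -> R[i], is_state f /\ forall x : A, star x = x -> f x = (l x)%:C.
Proof.
move=> A1 ll lmax.
have lD (x y : A) : l (x + y) = l x + l y.
  by have := ll 1 x y; rewrite mul1r realified_scaleE scale1r.
have l0 : l 0 = 0 by apply: (addrI (l 0)); rewrite -lD !addr0.
have lZ r (x : A) : l (r%:C *: x) = r * l x.
  by have := ll r x 0; rewrite addr0 l0 addr0.
have lN (x : A) : l (- x) = - l x by apply: (addrI (l x)); rewrite -lD !subrr l0.
pose h (x : A) := l ((2^-1)%:C *: (x + star x)).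
have hsa x : star x = x -> h x = l x by move=> sx; rewrite /h sx scale_halfD.
have hD x y : h (x + y) = h x + h y.
  by rewrite /h starD addrACA scalerDr lD.
have hZ r (x : A) : h (r%:C *: x) = r * h x.
  by rewrite /h starZr -scalerDr scalerA mulrC -scalerA lZ.
have hi x : star x = x -> h ('i *: x) = 0.
  move=> sx; rewrite /h starZ sx -scalerDl.
  by have -> : 'i + Num.conj 'i = 0 :> R[i]; rewrite ?scale0r ?scaler0 ?l0//;
     apply/eqP; rewrite eq_complex /= addr0 subrr !eqxx.
pose f x : R[i] := h x +i* - h ('i *: x).
have fsa x : star x = x -> f x = (l x)%:C.
  by move=> sx; rewrite /f hi// hsa// oppr0.
exists f; split=> //; split.
- move=> [r s] x y.
  have E : (r +i* s) *: x = r%:C *: x + s%:C *: ('i *: x).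
    rewrite scalerA -scalerDl; congr (_ *: _).
    by apply/eqP; rewrite eq_complex /=; apply/andP; split; apply/eqP; ring.
  have iE : 'i *: ((r +i* s) *: x) = r%:C *: ('i *: x) + (- s)%:C *: x.
    rewrite !scalerA -scalerDl; congr (_ *: _).
    by apply/eqP; rewrite eq_complex /=; apply/andP; split; apply/eqP; ring.
  rewrite /f scalerDr iE E !hD !hZ.
  by apply/eqP; rewrite eq_complex /=; apply/andP; split; apply/eqP; ring.
- move=> _ [b ->]; rewrite fsa ?starM ?starK// ler0c.
  rewrite -oppr_le0 -lN; apply: le_trans (lmax _) _; exact: spmax_N_star_mul.
- rewrite [aone](_ : _ = 1 :> A)// fsa ?star1//.
  suff -> : l 1 = 1 by [].
  apply/le_anti/andP; split.
    by rewrite (le_trans (lmax _))// -sc1 spmax_sc.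
  rewrite -lerN2 -lN (le_trans (lmax _))//.
  by rewrite -[X in - X](sc1 (A := A)) -scN spmax_sc.
Qed.

End RealFunctional.

(** * Averages over a Folner sequence *)

Section Averages.
Context {R : realType} {G : groupType} {A : cstarAlgType R}.
Variable Theta : G -> A -> A.
Hypothesis A_neq0 : (1 : A) != 0.
Hypothesis systemT : cstar_system Theta.
Implicit Types (a x y : A) (g h : G) (D E : {fset G}) (c r t : R).

Let Theta_linear g : linear (Theta g).
Proof. by have [_ /(_ g) [[]]] := systemT. Qed.

Lemma actD g x y : Theta g (x + y) = Theta g x + Theta g y.
Proof. by have := Theta_linear g 1 x y; rewrite !scale1r. Qed.

Lemma act0 g : Theta g 0 = 0.
Proof. by apply: (addrI (Theta g 0)); rewrite -actD !addr0. Qed.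

Lemma actZ g (k : R[i]) x : Theta g (k *: x) = k *: Theta g x.
Proof. by have := Theta_linear g k x 0; rewrite !addr0 act0 addr0. Qed.

Lemma actN g x : Theta g (- x) = - Theta g x.
Proof. by rewrite -scaleN1r actZ scaleN1r. Qed.

Lemma act_star g x : Theta g (star x) = star (Theta g x).
Proof. by have [_ /(_ g) [[_ _ ->]]] := systemT. Qed.

Lemma act1 g : Theta g 1 = 1.
Proof.
have [_ /(_ g) [[_ gM _] [k _ gK]]] := systemT.
by have := gM 1 (k 1); rewrite gK [amul 1 _]mul1r gK [amul _ 1]mulr1.
Qed.

Lemma nrm_act g x : nrm (Theta g x) <= nrm x.
Proof.
have [_ /(_ g) [gh _]] := systemT.
by apply: star_hom_contractive => //; exact: act1.
Qed.

Definition avg E a : A := (#|` E|)%:R^-1 *: \sum_(g <- E) Theta g a.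

Lemma avgE E a : avg E a = ((#|` E|)%:R^-1)%:C *: \sum_(g <- E) Theta g a.
Proof. by rewrite fmorphV rmorph_nat. Qed.

Lemma avgD E x y : avg E (x + y) = avg E x + avg E y.
Proof.
rewrite /avg -scalerDr -big_split; congr (_ *: _).
by apply: eq_bigr => g _; exact: actD.
Qed.

Lemma avgZ E (k : R[i]) x : avg E (k *: x) = k *: avg E x.
Proof.
rewrite /avg scalerA mulrC -scalerA; congr (_ *: _).
by rewrite scaler_sumr; apply: eq_bigr => g _; exact: actZ.
Qed.

Lemma avgN E x : avg E (- x) = - avg E x.
Proof. by rewrite -scaleN1r avgZ scaleN1r. Qed.

Lemma avg_star E x : star x = x -> star (avg E x) = avg E x.
Proof.
move=> sx; rewrite avgE starZr; congr (_ *: _).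
rewrite (big_morph star (@starD _ _) (@star0 _ _)).
by apply: eq_bigr => g _; rewrite -act_star sx.
Qed.

Lemma avg_sc E r : E != fset0 -> avg E (sc r) = sc r.
Proof.
move=> E0; rewrite /sc avgZ /avg; congr (_ *: _).
under eq_bigr do rewrite act1.
rewrite big_const_seq count_predT iter_addr_0 -[X in _ *: X]scaler_nat.
rewrite scalerA mulVf ?scale1r//.
by rewrite pnatr_eq0 cardfs_eq0.
Qed.

Lemma nrm_sum_act (s : seq G) x : nrm (\sum_(g <- s) Theta g x) <= (size s)%:R * nrm x.
Proof.
elim: s => [|g s IH]; first by rewrite big_nil nrm0 mul0r.
rewrite big_cons (le_trans (nrmD _ _))// /= -natr1 mulrDl mul1r addrC.
by rewrite lerD// nrm_act.
Qed.

Lemma nrm_avg E x : nrm (avg E x) <= nrm x.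
Proof.
have [->|E0] := eqVneq E fset0.
  by rewrite avgE big_seq_fset0 scaler0 nrm0 nrm_ge0.
rewrite avgE nrmZ ger0_norm ?invr_ge0// ler_pdivrMl ?ltr0n ?cardfs_gt0//.
exact: nrm_sum_act.
Qed.

Lemma sumB_fset (f : G -> A) D E : \sum_(g <- D) f g - \sum_(g <- E) f g =
  \sum_(g <- (D `\` E)%fset) f g - \sum_(g <- (E `\` D)%fset) f g.
Proof.
have split (B C : {fset G}) : \sum_(g <- B) f g =
    \sum_(g <- (B `&` C)%fset) f g + \sum_(g <- (B `\` C)%fset) f g.
  rewrite (big_fsetID _ (mem C)); congr (_ + _); apply: eq_fbigl => g;
    by rewrite !inE // andbC.
by rewrite (split D E) (split E D) fsetIC opprD addrACA subrr add0r.
Qed.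

(** Averaging the translate of [x] by [g] over [E] amounts to averaging [x] over
    [E g], so only the indices in the symmetric difference contribute. *)
Lemma nrm_avg_actB E g x : nrm (avg E (Theta g x - x)) <=
  (#|` symm_diff (fset_translate E g) E|)%:R / (#|` E|)%:R * nrm x.
Proof.
have actM h k y : Theta (h * k)%g y = Theta h (Theta k y).
  by have [[_ ->]] := systemT.
rewrite avgE nrmZ ger0_norm ?invr_ge0// [_ / _]mulrC -mulrA ler_wpM2l ?invr_ge0//.
under eq_bigr do rewrite actD actN -actM.
rewrite big_split /= sumrN.
have -> : \sum_(h <- E) Theta (h * g)%g x = \sum_(h <- fset_translate E g) Theta h x.
  by rewrite big_imfset//= => h k _ _; exact: mulIg.
rewrite sumB_fset (le_trans (nrmB _ _))//.
have -> : #|` symm_diff (fset_translate E g) E| =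
    (#|` (fset_translate E g `\` E)%fset| + #|` (E `\` fset_translate E g)%fset|)%N.
  rewrite cardfsU [X in (_ - #|` X|)%N](_ : _ = fset0) ?cardfs0 ?subn0//.
  by apply/fsetP => h; rewrite !inE; do 2 case: (h \in _).
by rewrite natrD mulrDl lerD// nrm_sum_act.
Qed.

Lemma state_avg (f : A -> R[i]) E x : is_state f -> E != fset0 ->
  (forall g a, f (Theta g a) = f a) -> f (avg E x) = f x.
Proof.
move=> sf E0 fT; rewrite /avg stateZ// (big_morph f (stateD sf) (state0 sf)).
under eq_bigr do rewrite fT.
rewrite big_const_seq count_predT iter_addr_0 -[f x *+ _]mulr_natl mulrA mulVf ?mul1r//.
by rewrite pnatr_eq0 cardfs_eq0.
Qed.

Section Folner.
Variable F : nat -> {fset G}.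
Hypothesis FF : right_folner R F.

Let F0 k : F k != fset0. Proof. by case: FF. Qed.

Let bounds x := [set c | exists N, forall k, (N <= k)%N -> nrm (avg (F k) x) <= c].

(** The upper limit of the norms of the averages. *)
Definition gauge_sup x : R := inf (bounds x).

Let bounds_lb x : lbound (bounds x) 0.
Proof. by move=> c [N /(_ N (leqnn N))]; apply: le_trans; exact: nrm_ge0. Qed.

Let bounds_nrm x : bounds x (nrm x).
Proof. by exists 0 => k _; exact: nrm_avg. Qed.

Lemma gauge_sup_le x c : bounds x c -> gauge_sup x <= c.
Proof. by apply: ge_inf; exists 0; exact: bounds_lb. Qed.

Lemma gauge_sup_lt x c : gauge_sup x < c ->
  exists N, forall k, (N <= k)%N -> nrm (avg (F k) x) < c.
Proof.
move=> /inf_lt[]; first by exists (nrm x).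
by move=> d [N h] dc; exists N => k /h /le_lt_trans; exact.
Qed.

Lemma gauge_sup_sublinear : sublinear (gauge_sup : realified A -> R).
Proof.
apply: (@sublinear_inf R (realified A) bounds) => [x|x||].
- by exists (nrm x).
- by exists 0; exact: bounds_lb.
- move=> x y c d [N hN] [N' hN']; exists (c + d) => //.
  exists (maxn N N') => k; rewrite geq_max => /andP[/hN hx /hN' hy].
  by rewrite avgD (le_trans (nrmD _ _))// lerD.
- move=> r x c r0 [N hN]; exists N => k /hN h.
  by rewrite realified_scaleE avgZ nrmZ gtr0_norm// ler_pM2l.
Qed.

Lemma gauge_sup1 : gauge_sup 1 = 1.
Proof.
apply/le_anti/andP; split.
  by apply: gauge_sup_le; rewrite -(nrm1 A_neq0); exact: bounds_nrm.
apply: lb_le_inf; first by exists (nrm (1 : A)).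
move=> c [N /(_ N (leqnn N))].
by rewrite -[X in avg _ X]sc1 avg_sc// sc1 nrm1.
Qed.

(** The asymptotic counterpart of [spmax]: for self-adjoint [x], the upper
    limit of the spectral maxima of the averages of [x]. *)
Definition spmax_sup x : R := tighten (gauge_sup : realified A -> R) (1 : A) x.

Lemma spmax_sup_le_spmax x : spmax_sup x <= spmax x.
Proof.
apply/ler_addgt0Pr => e e0.
have [|t t0 xt] := @spmax_lt _ _ A_neq0 x (spmax x + e); first by rewrite ltrDl.
have := @tighten_le R (realified A) gauge_sup (1 : A) gauge_sup_sublinear t x t0.
rewrite gauge_sup1 mulr1 -/(spmax_sup x).
have := gauge_sup_le (bounds_nrm (x + sc t)); rewrite -/(sc t); lra.
Qed.

Lemma spmax_sup_lt x c : spmax_sup x < c ->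
  exists N, forall k, (N <= k)%N -> spmax (avg (F k) x) < c.
Proof.
move=> /(@tighten_lt R (realified A) gauge_sup 1)[t t0].
rewrite gauge_sup1 mulr1 => /gauge_sup_lt[N hN]; exists N => k /hN.
rewrite realified_scaleE -/(sc t) avgD avg_sc//.
by have := spmax_le A_neq0 (avg (F k) x) t0; lra.
Qed.

(** The asymptotic spectral maximum at any self-adjoint element is attained by
    an invariant state: Hahn-Banach gives a functional dominated by
    [spmax_sup], which vanishes on differences [Theta g x - x]. *)
Lemma exists_invariant_state a : star a = a ->
  exists f : A -> R[i], [/\ is_state f, forall g x, f (Theta g x) = f x &
    f a = (spmax_sup a)%:C].
Proof.
move=> sa.
have [l [ll lp la]] := @hahn_banach R (realified A) spmax_sup a
  (@tighten_sublinear R (realified A) gauge_sup 1 gauge_sup_sublinear).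
have [|f [sf fl]] := @state_of_spmax _ _ l A_neq0 ll.
  by move=> x; exact: le_trans (lp x) (spmax_sup_le_spmax x).
have lT g x : l (Theta g x - x) <= 0.
  apply: le_trans (lp _) _.
  apply: le_trans (@tighten_le_id R (realified A) gauge_sup 1 gauge_sup_sublinear _) _.
  apply/ler_addgt0Pr => e e0; rewrite add0r; apply: gauge_sup_le.
  have [_ /(_ g)] := FF.
  move=> /cvgr_lt /(_ (e / (nrm x + 1))).
  have nx : 0 < nrm x + 1 by rewrite ltr_wpDl ?nrm_ge0.
  rewrite divr_gt0// => /(_ isT)[N _ hN]; exists N => k /hN /= h.
  apply: le_trans (nrm_avg_actB _ _ _) _.
  rewrite ltr_pdivlMr// in h.
  by apply: le_trans (ltW h); rewrite ler_wpM2l ?divr_ge0// lerDl.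
exists f; split=> // [g|]; last by rewrite fl// la.
suff fT : (fun x => f (Theta g x)) = f by move=> x; exact: (congr1 (@^~ x) fT).
have [fs _ _] := sf.
apply: scalar_eq_on_sa => // [k x y|x sx].
  by rewrite actD actZ fs.
have sT h : star (Theta h x) = Theta h x by rewrite -act_star sx.
rewrite !fl//; congr (_%:C).
have lB (y z : realified A) : l (y - z) = l y - l z.
  by rewrite addrC -scaleN1r ll mulN1r addrC.
apply/le_anti/andP; split.
  by rewrite -subr_le0 -lB.
rewrite -subr_le0 -lB.
have := lT g^-1%g (Theta g x).
have [[T1 TM] _] := systemT.
by rewrite -TM mulVg T1.
Qed.

End Folner.
End Averages.

(** * Unique ergodicity and the gauge *)

Section UnitalModel.
Context {R : realType} {H : hilbertType R} {M : vonNeumannType H}.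
Context {A : cstarAlgType R}.

Lemma bounded_op_eq (S T : bounded_op H) : (forall u, S u = T u) -> S = T.
Proof.
case: S T => [f fl fb] [g gl gb] /= /funext fg; rewrite -fg in gl gb *.
by congr BoundedOp; exact: Prop_irrelevance.
Qed.

Lemma wot_coef_continuous (u v : H) :
  continuous (fun T : wot H => inner ((T : bounded_op H) u) v : R[i]).
Proof.
move=> T.
apply: (@continuous_comp (wot H) {ptws H * H -> R[i]} R[i] (@op_coef R H)
  (fun f => f (u, v))).
  exact: initial_continuous.
exact: (@proj_continuous {classic (H * H)%type} (fun=> R[i]) (u, v)).
Qed.

(** [iota 1] is a projection fixing the range of every element of the range of
    [iota]; this passes to the weak operator closure, which contains [1]. *)
Lemma wot_dense_unital (iota : A -> M) :
  star_hom iota -> wot_dense (range iota) -> iota aone = aone.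
Proof.
move=> [il iM is_] dn; set p := iota aone.
have sp : star p = p by rewrite -is_ [star _](@star1 _ A).
have innerB (x y v : H) : inner (x - y) v = inner x v - inner y v.
  by rewrite addrC -scaleN1r inner_scalar mulN1r addrC.
have pT u v a : inner (vn_op (iota a) u) (vn_op p v) = inner (vn_op (iota a) u) v.
  rewrite -vn_op_star sp -vn_opM -iM; congr (inner (vn_op (iota _) _) _).
  exact: amul1x.
have pv u v : inner u (vn_op p v) = inner u v.
  pose S := [set T : wot H | inner ((T : bounded_op H) u) (vn_op p v) =
                            inner ((T : bounded_op H) u) v].
  have clS : closed S.
    have -> : S = (fun T : wot H => inner ((T : bounded_op H) u) (vn_op p v) -
         inner ((T : bounded_op H) u) v) @^-1` [set 0 : R[i]].
      apply/seteqP; split=> T /= /eqP; rewrite ?subr_eq0 => /eqP // ->.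
      by rewrite subrr.
    apply: closed_comp => [T _|].
      apply: (@cvgB _ R[i] _ (nbhs T) _
        (fun T : wot H => inner ((T : bounded_op H) u) (vn_op p v) : R[i])
        (fun T : wot H => inner ((T : bounded_op H) u) v : R[i]));
        exact: wot_coef_continuous.
    exact: (accessible_closed_set1 (hausdorff_accessible (@norm_hausdorff _ _))).
  have sub : closure ([set vn_op x | x in range iota] : set (wot H)) `<=` S.
    rewrite closureE; apply: smallest_sub => // _ [_ [a _ <-] <-].
    exact: pT.
  have := sub _ (dn _ (imageT (vn_op : M -> bounded_op H) aone)).
  by rewrite /S /= vn_op1.
apply: vn_op_inj; apply: bounded_op_eq => v; rewrite vn_op1.
apply/eqP; rewrite -subr_eq0 -normr_eq0 -sqrf_eq0 -inner_norm innerB.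
by rewrite subr_eq0 innerC [X in _ == X]innerC pv.
Qed.

End UnitalModel.

Section UniqueErgodicity.
Context {R : realType} {G : groupType} {A : cstarAlgType R}.
Variables (Theta : G -> A -> A) (tau : A -> R[i]).
Hypothesis systemT : cstar_system Theta.
Hypothesis tau_state : is_state tau.
Hypothesis tau_inv : forall g a, tau (Theta g a) = tau a.

Lemma state_neq0 : (1 : A) != 0.
Proof.
apply/eqP => A0; have := state1 tau_state; rewrite A0 state0// => /eqP.
by rewrite eq_sym oner_eq0.
Qed.

Let A_neq0 := state_neq0.

Lemma invariant_sa_of_state (f : A -> R[i]) (sf : is_state f) :
  (forall g a, f (Theta g a) = f a) -> invariant_states Theta (sa_of_state sf).
Proof. by []. Qed.

Lemma uniquely_ergodic_eq (f : A -> R[i]) : uniquely_ergodic Theta ->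
  is_state f -> (forall g a, f (Theta g a) = f a) -> f = tau.
Proof.
move=> [phi E] sf fT.
have := invariant_sa_of_state tau_state tau_inv; rewrite E => /= tE.
have := invariant_sa_of_state sf fT; rewrite E /= -tE.
by move=> /(congr1 (fun h : sa_dual A => h : A -> R[i])).
Qed.

Lemma state_le_avg (f : A -> R[i]) (D : {fset G}) a : is_state f ->
  (forall g a, f (Theta g a) = f a) -> D != fset0 -> star a = a ->
  f a <= `|avg Theta D a|.
Proof.
move=> sf fT D0 sa; rewrite -(state_avg a sf D0 fT) normE.
by apply: state_sa_le => //; apply: (avg_star systemT).
Qed.

Section Gauge.
Variable F : nat -> {fset G}.
Hypothesis FF : right_folner R F.

Let F0 k : F k != fset0. Proof. by case: FF. Qed.

(** Since [tau] is the only invariant state, it attains the asymptotic spectral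
    maximum both at [a] and at [- a]; hence the spectra of the averages of [a]
    concentrate at [tau a], and their norms with them. *)
Lemma uniquely_ergodic_avg_cvg a : uniquely_ergodic Theta -> positive a ->
  (fun k => `|avg Theta (F k) a|) @ \oo --> tau a.
Proof.
move=> ue pa; have sa := positive_star pa.
have supE x : star x = x -> tau x = (spmax_sup Theta F x)%:C.
  move=> sx; have [f [sf fT <-]] := exists_invariant_state A_neq0 systemT FF sx.
  by rewrite (uniquely_ergodic_eq ue sf fT).
have tau0 : 0 <= tau a by case: tau_state => _ + _; exact.
set r := spmax_sup Theta F a; have tr : tau a = r%:C by exact: supE.
have r0 : 0 <= r by rewrite -ler0c -tr.
have rN : spmax_sup Theta F (- a) = - r.
  apply: complexI; rewrite -supE; last by rewrite starN sa.
  by rewrite [RHS]rmorphN /= -tr stateN.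
rewrite tr; apply/cvgrPdist_le => e e0.
have eE : e = (complex.Re e)%:C by rewrite RRe_real ?gtr0_real.
have {}e0 : 0 < complex.Re e by rewrite -ltcR -eE.
have [|N hN] := @spmax_sup_lt _ _ _ _ A_neq0 systemT F FF a (r + complex.Re e).
  by rewrite ltrDl.
have [|N' hN'] := @spmax_sup_lt _ _ _ _ A_neq0 systemT F FF (- a) (r + complex.Re e).
  by rewrite rN; lra.
exists (maxn N N') => // k /=; rewrite geq_max => /andP[/hN h /hN' h'].
have lo : r <= nrm (avg Theta (F k) a).
  by rewrite -lecR -normE -tr; exact: state_le_avg.
have hi : nrm (avg Theta (F k) a) <= r + complex.Re e.
  apply: nrm_le_spmax => //; [exact: (avg_star systemT)|exact: ltW|].
  by rewrite -(avgN systemT) ltW.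
rewrite normE eE distrC -rmorphB /= ger0_norm; last by rewrite ler0c subr_ge0.
by rewrite lecR; lra.
Qed.

(** If the averaged norms of [a] diverged, so would those of [2 a], and the
    two formal limits would be the same default value; then [tau a = tau (2 a)],
    so [a = 0] by faithfulness. *)
Lemma gauge_avg_cvg a : faithful tau ->
  (forall a, positive a -> gauge Theta F a = tau a) -> positive a ->
  cvg ((fun k => `|avg Theta (F k) a|) @ \oo).
Proof.
move=> ft hG pa; apply: contrapT => ncv.
have p2 : positive (2%:C *: a).
  have [b ->] := pa; exists ((Num.sqrt 2)%:C *: b).
  rewrite -[RHS]/(star ((Num.sqrt 2)%:C *: b) * ((Num.sqrt 2)%:C *: b)).
  rewrite starZr -cscalerAl -cscalerAr scalerA -rmorphM -expr2.
  by rewrite sqr_sqrtr ?ler0n.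
have ncv2 : ~ cvg ((fun k => `|avg Theta (F k) (2%:C *: a)|) @ \oo).
  move=> cv; apply: ncv.
  have -> : (fun k => `|avg Theta (F k) a|) =
     (fun k => `|(2^-1)%:C : R[i]| * `|avg Theta (F k) (2%:C *: a)|).
    apply/funext => k; rewrite -normrZ -(avgZ systemT) scalerA -rmorphM.
    by rewrite mulVf ?pnatr_eq0// rmorph1 scale1r.
  by apply: is_cvgM; [exact: is_cvg_cst|].
have e1 := hG _ pa; have e2 := hG _ p2.
rewrite /gauge (dvgP ncv) in e1; rewrite /gauge (dvgP ncv2) e1 stateZ// in e2.
have t0 : tau a = 0.
  have two : (2%:C : R[i]) = 1 + 1 by rewrite -[2]/(1 + 1) rmorphD rmorph1.
  by apply: (addrI (tau a)); rewrite addr0 {3}e2 two mulrDl mul1r.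
apply: ncv; rewrite (ft _ pa t0).
have -> : (fun k => `|avg Theta (F k) 0|) = (fun=> 0).
  apply/funext => k; rewrite -[X in avg _ _ X](scale0r (0 : A)).
  by rewrite (avgZ systemT) scale0r normr0.
exact: is_cvg_cst.
Qed.

(** An invariant state [f] satisfies [f <= gauge = tau] on positive elements.
    Applying this to [c - x] for large scalars [c] gives the reverse
    inequality. *)
Lemma uniquely_ergodic_of_gauge : faithful tau ->
  (forall a, positive a -> gauge Theta F a = tau a) -> uniquely_ergodic Theta.
Proof.
move=> ft hG; exists (sa_of_state tau_state); apply/seteqP; split=> [f [sf fT]|f ->];
  last exact: invariant_sa_of_state.
apply: val_inj => /=.
have le_pos a : positive a -> (f a : R[i]) <= tau a.
  move=> pa; rewrite -(hG _ pa).
  have cv : (fun k => `|avg Theta (F k) a|) @ \oo --> gauge Theta F a.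
    exact: gauge_avg_cvg ft hG pa.
  have t0 : 0 <= gauge Theta F a by rewrite hG//; case: tau_state => _ + _; exact.
  have f0 : 0 <= (f a : R[i]) by case: sf => _ + _; exact.
  have tE := RRe_real (ger0_real t0); have fE := RRe_real (ger0_real f0).
  rewrite -tE -[f a]fE lecR; apply/ler_addgt0Pr => e e0.
  have [|N _ /(_ N (leqnn N))] := (cvgrPdist_le _ _).1 cv e%:C; first by rewrite ltcR.
  have := state_le_avg sf fT (F0 N) (positive_star pa).
  rewrite normE -tE -fE distrC -rmorphB /= !lecR => fa.
  rewrite /Normc.normc /= expr0n addr0 sqrtr_sqr => /(le_trans (ler_norm _)).
  by lra.
have le_sa x : star x = x -> tau x <= f x.
  move=> sx; have [|s [ss _ s2 _]] := @sqrt_scB _ _ x (nrm x + 1) sx.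
    by rewrite ltrDl.
  have := le_pos (s * s); rewrite s2 !stateD// !stateN// !state_sc//.
  rewrite lerD2l lerN2; apply; exists s.
  by rewrite ss -s2.
have [fl _ _] := sf; have [tl _ _] := tau_state.
apply: scalar_eq_on_sa => // x sx; apply/le_anti/andP; split; last exact: le_sa.
by have := le_sa (- x); rewrite !stateN// lerN2; apply; rewrite starN sx.
Qed.

End Gauge.
End UniqueErgodicity.

Theorem theorem3p10 (R : realType) (G : groupType)
    (H : hilbertType R) (M : vonNeumannType H)
    (rho : M -> R[i]) (Xi : G -> M -> M)
    (L2 : hilbertType R) (Lambda : M -> L2)
    (A : cstarAlgType R) (Theta : G -> A -> A) (iota : A -> M)
    (G_countable : countable [set: G]) (G_amenable : amenable R G)
    (W_system : wstar_system rho Xi)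
    (L2_completion : is_L2_completion rho Lambda)
    (L2_separable : separable L2)
    (model : faithful_cstar_model Xi Theta iota)
    (A_separable : separable A) :
  (uniquely_ergodic Theta <-> strictly_ergodic Theta) /\
  (forall F : nat -> {fset G}, right_folner R F ->
    (uniquely_ergodic Theta ->
       forall a, positive a -> gauge Theta F a = rho (iota a)) /\
    (is_simplex (invariant_states Theta) ->
       (forall a, positive a -> gauge Theta F a = rho (iota a)) ->
       uniquely_ergodic Theta)).
Proof.
have [[rho_state rho_faithful _ _] [_ _ rho_Xi]] := W_system.
have [[systemT iota_hom iota_dense _ Xi_iota] iota_inj] := model.
have iota1 := wot_dense_unital iota_hom iota_dense.
have [il iM iS] := iota_hom.
have i0 : iota 0 = 0.
  by apply: (addrI (iota 0)); have := il 1 0 0; rewrite !scale1r !addr0.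
have i_pos a : positive a -> positive (iota a).
  by move=> [b ->]; exists (iota b); rewrite iM iS.
pose tau (a : A) := rho (iota a).
have tau_state : is_state tau.
  split=> [c x y|a pa|].
  - by rewrite /tau il; case: rho_state => + _ _; apply.
  - by case: rho_state => _ + _; apply; exact: i_pos.
  - by rewrite /tau [iota _]iota1; case: rho_state.
have tau_inv g a : tau (Theta g a) = tau a by rewrite /tau -Xi_iota rho_Xi.
have tau_faithful : faithful tau.
  move=> a pa ta; apply: iota_inj; rewrite i0.
  by apply: rho_faithful => //; exact: i_pos.
split.
  split=> [[phi E]|[phi [E _]]]; exists phi => //; split=> //.
  have := invariant_sa_of_state tau_state tau_inv; rewrite E => /= <-.
  exact: tau_faithful.
move=> F FF; split=> [ue a pa|_ hG].
  apply/cvg_lim; first exact: norm_hausdorff.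
  exact: (uniquely_ergodic_avg_cvg systemT tau_state tau_inv FF ue pa).
exact: (uniquely_ergodic_of_gauge systemT tau_state tau_inv FF tau_faithful hG).
Qed.
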